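(* Let $X$ be a bounded geometry metric space (distances equal to $+\infty$ are allowed). If $X$ does not have property A, then the uniform Roe algebra $C^*_u(X)$ contains a ghost operator that is not compact. Consequently, $X$ has property A if and only if every ghost operator in $C^*_u(X)$ is compact.
   Context: A metric space $X$ (possibly with some distances $+\infty$) has bounded geometry if for each $R>0$ there is $N$ such that every ball of radius $R$ contains at most $N$ points. Let $\ell^2(X)$ have orthonormal basis $\{\delta_x\}_{x\in X}$ and write $T_{xy}=\langle\delta_x,T\delta_y\rangle$ for a bounded operator $T$. The propagation of $T$ is $\sup\{d(x,y): T_{xy}\neq 0\}$; $\mathbb{C}_R[X]$ denotes the bounded operators of propagation at most $R$, $\mathbb{C}_u[X]=\bigcup_{R\ge 0}\mathbb{C}_R[X]$, and the uniform Roe algebra $C^*_u(X)$ is the norm closure of $\mathbb{C}_u[X]$ in $\mathfrak{B}(\ell^2(X))$. An operator $T\in C^*_u(X)$ is a ghost if $T_{xy}\to 0$ as $x,y\to\infty$ in $X$ (i.e. for every $\epsilon>0$ there is a finite $F\subseteq X$ with $|T_{xy}|<\epsilon$ whenever $x\notin F$ or $y\notin F$). $X$ has property A if there is a sequence $(k_n)$ of positive definite kernels on $X\times X$ such that (a) for each $n$ there is $r$ with $k_n(x,y)=0$ whenever $d(x,y)>r$, and (b) for every $s>0$ and $\epsilon>0$ there is $N$ such that $1-\epsilon\le k_n(x,y)\le 1$ for all $n>N$ and all $x,y$ with $d(x,y)<s$. *)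

(* Defs.v *)
From mathcomp Require Import all_boot all_order all_algebra.
From mathcomp Require Export complex.
From mathcomp Require Export reals constructive_ereal.
Export Order.TTheory GRing.Theory Num.Theory ComplexField.

Set Implicit Arguments.
Unset Strict Implicit.
Unset Printing Implicit Defensive.

Local Open Scope ring_scope.

Section Defs.
Variable R : realType.
Variable X : choiceType.

Definition is_emetric (d : X -> X -> \bar R) : Prop :=
  [/\ (forall x y, (0 <= d x y)%E),
      (forall x y, d x y = 0%E <-> x = y),
      (forall x y, d x y = d y x) &
      (forall x y z, (d x z <= d x y + d y z)%E)].

Definition bounded_geometry (d : X -> X -> \bar R) : Prop :=
  forall r : R, 0 < r -> exists N : nat, forall (x : X) (s : seq X),
    uniq s -> (forall y, y \in s -> (d x y <= r%:E)%E) -> (size s <= N)%N.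

(** An operator on l^2(X) is represented by its matrix
    T x y = < delta_x, T delta_y >. *)
Definition opmat := X -> X -> R[i].

Definition sqnorm_on (F : seq X) (f : X -> R[i]) : R[i] :=
  \sum_(x <- F) `|f x| ^+ 2.

Definition form_on (T : opmat) (F : seq X) (f g : X -> R[i]) : R[i] :=
  \sum_(x <- F) \sum_(y <- F) (g x)^* * T x y * f y.

(** The opmat T defines a bounded operator of norm <= c
    (on finitely supported vectors, hence on all of l^2(X)). *)
Definition bounded_by (T : opmat) (c : R) : Prop :=
  forall (F : seq X) (f g : X -> R[i]), uniq F ->
    `|form_on T F f g| ^+ 2 <= (c ^+ 2)%:C%C * sqnorm_on F g * sqnorm_on F f.

Definition bounded_op (T : opmat) : Prop := exists c : R, bounded_by T c.

Definition mat_sub (T S : opmat) : opmat := fun x y => T x y - S x y.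

Definition prop_le (d : X -> X -> \bar R) (T : opmat) (r : R) : Prop :=
  forall x y, T x y != 0 -> (d x y <= r%:E)%E.

Definition finite_prop_op (d : X -> X -> \bar R) (T : opmat) : Prop :=
  bounded_op T /\ exists r : R, 0 <= r /\ prop_le d T r.

Definition in_uniform_roe (d : X -> X -> \bar R) (T : opmat) : Prop :=
  bounded_op T /\
  forall eps : R, 0 < eps -> exists S : opmat,
    finite_prop_op d S /\ bounded_by (mat_sub T S) eps.

Definition ghost (d : X -> X -> \bar R) (T : opmat) : Prop :=
  in_uniform_roe d T /\
  forall eps : R, 0 < eps -> exists F : seq X, forall x y,
    (x \notin F) || (y \notin F) -> `|T x y| < eps%:C%C.

Definition in_l2 (f : X -> R[i]) : Prop :=
  exists M : R, forall F : seq X, uniq F -> sqnorm_on F f <= M%:C%C.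

Definition finite_rank (K : opmat) : Prop :=
  exists (n : nat) (u v : 'I_n -> X -> R[i]),
    (forall k, in_l2 (u k)) /\ (forall k, in_l2 (v k)) /\
    forall x y, K x y = \sum_(k < n) u k x * (v k y)^*.

Definition compact_op (T : opmat) : Prop :=
  bounded_op T /\
  forall eps : R, 0 < eps -> exists K : opmat,
    finite_rank K /\ bounded_by (mat_sub T K) eps.

Definition pos_def_kernel (k : X -> X -> R) : Prop :=
  forall (m : nat) (p : 'I_m -> X) (lam : 'I_m -> R[i]),
    0 <= \sum_(i < m) \sum_(j < m) lam i * (lam j)^* * (k (p i) (p j))%:C%C.

Definition property_A (d : X -> X -> \bar R) : Prop :=
  exists k : nat -> X -> X -> R,
    (forall n, pos_def_kernel (k n)) /\
    (forall n, exists r : R, forall x y, (r%:E < d x y)%E -> k n x y = 0) /\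
    (forall s eps : R, 0 < s -> 0 < eps -> exists N : nat, forall n : nat,
       (N < n)%N -> forall x y, (d x y < s%:E)%E ->
         1 - eps <= k n x y <= 1).

End Defs.

(* Main.v *)
(** If X has property A, Schur multiplication by the kernels k_n does not
    increase the norm and tends to the identity on C*_u(X); a ghost is thus a
    norm limit of ghosts of finite propagation, which are compact by bounded
    geometry.

    Conversely, suppose that for some r, e no positive definite kernel k of
    finite propagation has k(x,x) <= 1 and k(x,y) >= 1 - e when d(x,y) <= r.
    By compactness this fails, for each S, already for kernels of propagation S
    on a finite set Y, which can be chosen disjoint from any given finite set.
    Minimising a quadratic penalty over the cone of positive definite kernels of
    propagation <= S yields dual weights w(x,y) >= 0 on the pairs with
    d(x,y) <= r and mu(x) >= 0 such that  sum w h <= sum mu(x) h(x,x)  for all h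
    in the cone, while  sum mu <= (1 - e) sum w.  Hence T = D^-1/2 w D^-1/2 with
    D = diag(mu) has propagation <= r, satisfies <T f, f> <= |f|^2 whenever f is
    supported in a set of diameter <= S, but has <T xi, xi> >= (1 + e) |xi|^2 for
    xi = mu^1/2.

    Let f(t) = (t - 1 - e/2)_+.  As f(t) >= t - 1 - e/2, the form of f(T) at xi is
    at least (e/2) |xi|^2.  On the other hand (T + N)^k delta_x is supported in a
    ball of radius kr, so for S = 2kr the local estimate applies to it and forces
    the spectral measure of delta_x to have mass exponentially small in k on
    [1 + e/2, +oo).  So the entries of f(T) are small.  Since f is a uniform limit
    of polynomials, the block sum of the operators f(T) over disjoint sets Y_k, with
    S = S_k tending to infinity, is a ghost in C*_u(X); it is not compact. *)
Require Import Defs.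
From mathcomp Require Import all_boot all_order all_algebra.
From mathcomp Require Import complex reals constructive_ereal.
From mathcomp Require Import boolp classical_sets filter topology normedtype sequences.
From mathcomp Require Import ring lra.
Import Order.TTheory GRing.Theory Num.Theory ComplexField.
Import numFieldNormedType.Exports.
Local Open Scope ring_scope.
Set Implicit Arguments.
Unset Strict Implicit.
Unset Printing Implicit Defensive.

(** * Norm bounds and spectral decomposition *)

Section ComplexNumbers.
Variable R : realType.
Implicit Types (z : R[i]) (I : Type).

Definition sqn z : R := complex.Re z ^+ 2 + complex.Im z ^+ 2.

Lemma sqnE z : `|z| ^+ 2 = (sqn z)%:C%C.
Proof. by rewrite -add_Re2_Im2. Qed.

Lemma sqn_ge0 z : 0 <= sqn z.
Proof. by rewrite addr_ge0 // sqr_ge0. Qed.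

Lemma sqnM z1 z2 : sqn (z1 * z2) = sqn z1 * sqn z2.
Proof. by apply: complexI; rewrite rmorphM /= -!sqnE normrM exprMn. Qed.

Lemma sqnJ z : sqn z^* = sqn z.
Proof. by case: z => a b; rewrite /sqn /= sqrrN. Qed.

Lemma sqnN z : sqn (- z) = sqn z.
Proof. by case: z => a b; rewrite /sqn /= !sqrrN. Qed.

Lemma sqnC (x : R) : sqn x%:C%C = x ^+ 2.
Proof. by rewrite /sqn /= expr0n addr0. Qed.

Lemma sqn0 : sqn 0 = 0. Proof. by rewrite -[0]/((0 : R)%:C%C) sqnC expr0n. Qed.

Lemma sqn_Cr z : (sqn z)%:C%C = z * z^*.
Proof. by rewrite -sqnE sqr_normc. Qed.

Lemma normc_lt z (e : R) : 0 < e -> (`|z| < e%:C%C) = (sqn z < e ^+ 2).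
Proof.
move=> e0; rewrite -ltr_sqr ?nnegrE ?normr_ge0 //; last first.
  by rewrite ler0c ltW.
by rewrite sqnE -rmorphXn /= ltcR.
Qed.

Lemma Re_sum I (s : seq I) (P : pred I) (F : I -> R[i]) :
  complex.Re (\sum_(i <- s | P i) F i) = \sum_(i <- s | P i) complex.Re (F i).
Proof. by apply: (big_morph (@complex.Re R)) => // -[a b] [c d]. Qed.

Lemma ReZ (a : R) z : complex.Re (a%:C%C * z) = a * complex.Re z.
Proof. by case: z => x y /=; rewrite mul0r subr0. Qed.

(** The arithmetic-geometric mean inequality 2 sqrt(ab) <= a + b, in squared form. *)
Lemma Re_le z (c a b : R) : 0 <= c -> 0 <= a -> 0 <= b ->
  sqn z <= c ^+ 2 * a * b -> 2 * complex.Re z <= c * (a + b).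
Proof.
move=> c0 a0 b0 h.
have h1 : (2 * complex.Re z) ^+ 2 <= (c * (a + b)) ^+ 2.
  have := sqr_ge0 (complex.Im z); have := mulr_ge0 (sqr_ge0 c) (sqr_ge0 (a - b)).
  move: h; rewrite /sqn; nra.
apply: le_trans (ler_norm _) _.
rewrite -ler_sqr ?nnegrE ?mulr_ge0 ?addr_ge0 //.
by rewrite real_normK ?num_real.
Qed.

End ComplexNumbers.

Section Operators.
Variable R : realType.
Variable X : choiceType.
Implicit Types (T S : opmat R X) (F : seq X) (f g : X -> R[i]).

Definition sqs F f : R := \sum_(x <- F) sqn (f x).

Lemma sqs_ge0 F f : 0 <= sqs F f.
Proof. by apply: sumr_ge0 => x _; exact: sqn_ge0. Qed.

Lemma sqnorm_onE F f : sqnorm_on F f = (sqs F f)%:C%C.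
Proof. by rewrite /sqnorm_on /sqs raddf_sum /=; apply: eq_bigr => x _; exact: sqnE. Qed.

(* Unlike [bounded_by], this form of the norm bound is additive in the pair
   (f, g), hence in orthogonal decompositions and in the operator. *)
Definition form_bound T (c : R) := forall F f g, uniq F ->
  2 * complex.Re (form_on T F f g) <= c * (sqs F f + sqs F g).

Lemma form_onZ T F f g (z : R[i]) :
  form_on T F (fun x => z * f x) g = z * form_on T F f g.
Proof.
rewrite /form_on big_distrr /=; apply: eq_bigr => x _.
by rewrite big_distrr /=; apply: eq_bigr => y _; rewrite mulrCA.
Qed.

Lemma form_bound_bounded T c : 0 <= c -> form_bound T c -> bounded_by T c.
Proof.
move=> c0 h F f g uF; rewrite !sqnorm_onE sqnE -!rmorphM /= lecR.
set z := form_on T F f g; set A := sqs F f; set B := sqs F g.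
have A0 : 0 <= A by exact: sqs_ge0.
have B0 : 0 <= B by exact: sqs_ge0.
have Z0 := sqn_ge0 z.
(* Replacing f by s z^* f makes the form the real number s |z|^2. The best s is 1 / (c A); if c A =
   0 and z is nonzero, a large s gives a contradiction. *)
have key (s : R) : 2 * (s * sqn z) <= c * (s ^+ 2 * sqn z * A + B).
  have := h F (fun x => (s%:C%C * z^*) * f x) g uF.
  rewrite form_onZ -/z -mulrA [z^* * z]mulrC -sqn_Cr -rmorphM /=.
  congr (_ <= c * (_ + B)); rewrite /A /sqs big_distrr /=; apply: eq_bigr => x _.
  by rewrite !sqnM sqnC sqnJ.
have [zZ|zZ] := eqVneq (sqn z) 0; first by rewrite zZ !mulr_ge0.
have Zp : 0 < sqn z by rewrite lt_neqAle eq_sym zZ.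
have [cA|cA] := eqVneq (c * A) 0.
  have := key ((c * B + 1) / sqn z).
  have -> : (c * B + 1) / sqn z * sqn z = c * B + 1 by rewrite divfK.
  set q := (_ / _) ^+ 2; have -> : c * (q * sqn z * A + B) = (c * A) * (q * sqn z) + c * B by ring.
  rewrite cA mul0r add0r; have := mulr_ge0 c0 B0; lra.
have cAp : 0 < c * A by rewrite lt_neqAle eq_sym cA mulr_ge0.
have := key (c * A)^-1.
have -> : c * ((c * A)^-1 ^+ 2 * sqn z * A + B) = (c * A)^-1 * sqn z + c * B.
  rewrite mulrDr; congr (_ + _).
  have -> : c * ((c * A)^-1 ^+ 2 * sqn z * A) = (c * A)^-1 * ((c * A)^-1 * (c * A)) * sqn z by ring.
  by rewrite mulVf // mulr1.
move=> k1; have : (c * A)^-1 * sqn z <= c * B by lra.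
by rewrite mulrC ler_pdivrMr //; lra.
Qed.

(** [bounded_by] sees c only through its square, so c may be negative. *)
Lemma bounded_form_bound T c : bounded_by T c -> form_bound T `|c|.
Proof.
move=> h F f g uF; apply: Re_le; rewrite ?normr_ge0 ?sqs_ge0 //.
have := h F f g uF; rewrite !sqnorm_onE sqnE -!rmorphM /= lecR.
by rewrite real_normK ?num_real //; lra.
Qed.

Lemma bounded_form_bound_ge0 T c : 0 <= c -> bounded_by T c -> form_bound T c.
Proof. by move=> c0 /bounded_form_bound; rewrite ger0_norm. Qed.

Lemma eq_form_on T S F f g :
  (forall x y, T x y = S x y) -> form_on T F f g = form_on S F f g.
Proof.
by move=> h; apply: eq_bigr => x _; apply: eq_bigr => y _; rewrite h.
Qed.

Lemma form_onD T S F f g :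
  form_on (fun x y => T x y + S x y) F f g = form_on T F f g + form_on S F f g.
Proof.
rewrite /form_on -big_split /=; apply: eq_bigr => x _.
by rewrite -big_split /=; apply: eq_bigr => y _; rewrite mulrDr mulrDl.
Qed.

Lemma form_boundD T S c e : form_bound T c -> form_bound S e ->
  form_bound (fun x y => T x y + S x y) (c + e).
Proof.
move=> hT hS F f g uF; have := hT F f g uF; have := hS F f g uF.
by rewrite form_onD raddfD /= mulrDr; lra.
Qed.

Lemma eq_form_bound T S c : (forall x y, T x y = S x y) ->
  form_bound T c -> form_bound S c.
Proof. by move=> e h F f g uF; rewrite -(eq_form_on F f g e); exact: h. Qed.

Lemma form_boundN T c : form_bound T c -> form_bound (fun x y => - T x y) c.
Proof.
move=> h F f g uF; have := h F (fun x => - f x) g uF.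
have -> : form_on T F (fun x => - f x) g = form_on (fun x y => - T x y) F f g.
  apply: eq_bigr => x _; apply: eq_bigr => y _.
  by rewrite mulrN mulrN mulNr.
congr (_ <= _ * (_ + _)).
by apply: eq_bigr => x _; rewrite sqnN.
Qed.

Lemma form_bound_entry T c x y : 0 <= c -> bounded_by T c -> sqn (T x y) <= c ^+ 2.
Proof.
move=> c0 h.
pose delta (a z : X) : R[i] := if z == a then 1 else 0.
have sqd a F : uniq F -> a \in F -> sqs F (delta a) = 1.
  move=> uF aF; rewrite /sqs (bigD1_seq a) //= /delta eqxx sqnC expr1n.
  rewrite big1 ?addr0 // => z /negbTE ->; exact: sqn0.
pose F := undup [:: x; y].
have uF : uniq F by exact: undup_uniq.
have xF : x \in F by rewrite mem_undup !inE eqxx.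
have yF : y \in F by rewrite mem_undup !inE eqxx orbT.
have := h F (delta y) (delta x) uF.
rewrite !sqnorm_onE !sqd // !mulr1.
have -> : form_on T F (delta y) (delta x) = T x y.
  rewrite /form_on (bigD1_seq x) //= [X in _ + X]big1 ?addr0; last first.
    by move=> z /negbTE zx; rewrite big1 // => w _; rewrite /delta zx conjC0 !mul0r.
  rewrite (bigD1_seq y) //= big1 ?addr0; last first.
    by move=> z /negbTE zx; rewrite /delta zx mulr0.
  by rewrite /delta !eqxx conjC1 mul1r mulr1.
by rewrite sqnE lecR.
Qed.

End Operators.

Section Spectral.
Variable R : realType.
Variable X : choiceType.

(** Unitary diagonalisation of the matrix of k on F, which is real symmetric and hence Hermitian.
    Eigenvectors are carried back to functions on X and extended by zero; orthonormality and
    completeness are P P^* = 1 and P^* P = 1. *)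
Lemma spectral_seq (k : X -> X -> R) (F : seq X) : uniq F ->
  (forall x y, k x y = k y x) ->
  exists (n : nat) (d : 'I_n -> R) (q : 'I_n -> X -> R[i]),
  [/\ forall i j, \sum_(x <- F) q i x * (q j x)^* = (i == j)%:R,
      forall x y, x \in F -> y \in F ->
        \sum_j q j x * (q j y)^* = (x == y)%:R,
      forall x y, x \in F -> y \in F ->
        (k x y)%:C%C = \sum_j (d j)%:C%C * (q j x * (q j y)^*) &
      forall j x, x \notin F -> q j x = 0].
Proof.
move=> uF ksym.
pose n := size F; pose pt (i : 'I_n) := tnth (in_tuple F) i.
pose A : 'M[R[i]]_n := \matrix_(i, j) (k (pt i) (pt j))%:C%C.
pose P := spectralmx A; pose D := spectral_diag A.
have PU : P \is unitarymx by exact: spectral_unitarymx.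
have realC (x : R) : (x%:C%C : R[i]) \is Num.real by rewrite complex_real.
have Aherm : A \is hermsymmx.
  apply: realsym_hermsym.
    by apply/is_hermitianmxP; rewrite expr0 scale1r map_mx_id //; apply/matrixP => i j; rewrite !mxE ksym.
  by apply/mxOverP => i j; rewrite mxE.
have Aeq := orthomx_spectralP (hermitian_normalmx Aherm).
have Dreal := hermitian_spectral_diag_real Aherm.
rewrite -/P -/D invmx_unitary // in Aeq.
(* Since A = P^* D P, the eigenvectors are the columns of P^*, whence the conjugate. *)
pose q (j : 'I_n) x : R[i] :=
  if insub (index x F) is Some i then (P j i)^* else 0.
have ptF i : pt i \in F by exact: mem_tnth.
have idx i : index (pt i) F = i.
  by rewrite /pt (tnth_nth (pt i)) /= index_uniq.
have qpt j i : q j (pt i) = (P j i)^*.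
  rewrite /q; case: insubP => [u _ /eqP|]; last by rewrite idx ltn_ord.
  by rewrite idx => /eqP /val_inj ->.
have Fpt x : x \in F -> exists i, x = pt i.
  by move=> /seq_tnthP [i ->]; exists i.
have ptI i j : (pt i == pt j) = (i == j).
  apply/eqP/eqP => [h|-> //]; apply: val_inj => /=.
  by rewrite -[LHS]idx -[RHS]idx h.
exists n, (fun j => complex.Re (D 0 j)), q; split.
- move=> i j; rewrite big_tnth.
  have /matrixP/(_ j i) := unitarymxP PU; rewrite !mxE eq_sym => <-.
  apply: eq_bigr => l _; rewrite !mxE.
  have -> : tnth (in_tuple F) l = pt l by [].
  by rewrite !qpt conjCK mulrC.
- move=> _ _ /Fpt[i ->] /Fpt[j ->]; rewrite ptI.
  have := mulmx1C (unitarymxP PU).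
  move=> /matrixP/(_ i j); rewrite !mxE => <-.
  by apply: eq_bigr => l _; rewrite !mxE !qpt conjCK.
- move=> _ _ /Fpt[i ->] /Fpt[j ->].
  have /matrixP/(_ i j) := Aeq; rewrite !mxE => ->.
  apply: eq_bigr => l _; rewrite !qpt conjCK.
  rewrite !mxE (bigD1 l) //= big1 ?addr0; last first.
    by move=> m ml; rewrite !mxE (negbTE ml) mulr0n mulr0.
  rewrite !mxE eqxx mulr1n RRe_real; last by move/mxOverP: Dreal.
  by rewrite mulrAC mulrA [_ * D 0 l]mulrC -!mulrA.
- move=> j x xF; rewrite /q; case: insubP => // u.
  by rewrite index_mem (negbTE xF).
Qed.

End Spectral.

Section Calculus.
Variable R : realType.
Variable X : choiceType.
Implicit Types (T S : opmat R X) (F Y : seq X) (f g : X -> R[i]).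

Lemma sum_seqI (V : nmodType) F Y (h : X -> V) : uniq F -> uniq Y ->
  \sum_(x <- F | x \in Y) h x = \sum_(x <- Y | x \in F) h x.
Proof.
move=> uF uY; rewrite -big_filter -[RHS]big_filter; apply: perm_big.
by apply: uniq_perm; rewrite ?filter_uniq // => x; rewrite !mem_filter andbC.
Qed.

Lemma sum_support (V : nmodType) F Y (h : X -> V) : uniq F -> uniq Y ->
  (forall x, x \in F -> x \notin Y -> h x = 0) ->
  \sum_(x <- F) h x = \sum_(x <- Y | x \in F) h x.
Proof.
move=> uF uY h0; rewrite -sum_seqI //.
rewrite (bigID (fun x => x \in Y)) /= [X in _ + X]big1_seq ?addr0 //.
by move=> x /andP[xY xF]; exact: h0.
Qed.

Definition restr F f : X -> R[i] := fun x => if x \in F then f x else 0.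

Lemma sqs_cut F Y f : uniq F -> uniq Y -> sqs Y (restr F f) <= sqs F f.
Proof.
move=> uF uY; rewrite [leRHS](bigID (fun x => x \in Y)) /= sum_seqI //.
rewrite -[leLHS]addr0 lerD ?sumr_ge0 // => [|x _]; last exact: sqn_ge0.
rewrite [leRHS]big_mkcond /= le_eqVlt; apply/orP; left; apply/eqP.
by apply: eq_bigr => x _; rewrite /restr; case: ifP => // _; exact: sqn0.
Qed.

(** An operator living on Y x Y sees only the points common to F and Y. This moves a form from an
    arbitrary F to Y, where the eigenvectors are orthonormal. *)
Lemma form_on_cut T F Y f g : uniq F -> uniq Y ->
  (forall x y, (x \notin Y) || (y \notin Y) -> T x y = 0) ->
  form_on T F f g = form_on T Y (restr F f) (restr F g).
Proof.
move=> uF uY T0; rewrite /form_on (sum_support (Y := Y)) //; last first.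
  by move=> x _ xY; rewrite big1 // => y _; rewrite T0 ?xY // mulr0 mul0r.
rewrite big_mkcond /=; apply: eq_bigr => x _; rewrite /restr.
case: ifP => xF; last by rewrite big1 // => y _; rewrite conjC0 !mul0r.
rewrite (sum_support (Y := Y)) //; last first.
  by move=> y _ yY; rewrite T0 ?yY ?orbT // mulr0 mul0r.
rewrite big_mkcond /=; apply: eq_bigr => y _.
by case: ifP => // _; rewrite mulr0.
Qed.

Variables (Y : seq X) (n : nat) (d : 'I_n -> R) (q : 'I_n -> X -> R[i]).
Hypothesis uY : uniq Y.
Hypothesis q_orth : forall i j, \sum_(x <- Y) q i x * (q j x)^* = (i == j)%:R.
Hypothesis q_complete : forall x y, x \in Y -> y \in Y ->
  \sum_j q j x * (q j y)^* = (x == y)%:R.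
Hypothesis q_supp : forall j x, x \notin Y -> q j x = 0.

(** If an operator has eigenvalues e_j for the eigenvectors [q j], then a j = phi(e_j) gives phi of
    that operator. *)
Definition calc (a : 'I_n -> R) : opmat R X :=
  fun x y => \sum_j (a j)%:C%C * (q j x * (q j y)^*).

Definition coef f j : R[i] := \sum_(x <- Y) (q j x)^* * f x.

Lemma calc_supp a x y : (x \notin Y) || (y \notin Y) -> calc a x y = 0.
Proof.
move=> /orP[h|h]; rewrite /calc big1 // => j _; rewrite (q_supp j h).
  by rewrite mul0r mulr0.
by rewrite conjC0 !mulr0.
Qed.

Lemma calcB a b x y : calc (fun j => a j - b j) x y = calc a x y - calc b x y.
Proof.
rewrite /calc -sumrB; apply: eq_bigr => j _.
by rewrite rmorphB /= mulrBl.
Qed.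

Lemma coef_parseval f : \sum_j sqn (coef f j) = sqs Y f.
Proof.
apply: complexI; rewrite !rmorph_sum /=.
transitivity (\sum_j \sum_(x <- Y) \sum_(y <- Y)
    (f x * (f y)^*) * (q j y * (q j x)^*)).
  apply: eq_bigr => j _; rewrite sqn_Cr /coef rmorph_sum /= big_distrlr /=.
  apply: eq_bigr => x _; apply: eq_bigr => y _.
  by rewrite rmorphM /= conjCK; ring.
rewrite exchange_big /= big_seq [RHS]big_seq; apply: eq_bigr => x xY.
rewrite exchange_big /= (bigD1_seq x) //= [X in _ + X]big1_seq ?addr0; last first.
  move=> y /andP[yx yF]; rewrite -big_distrr /= q_complete //.
  by rewrite (negbTE yx) mulr0.
by rewrite -big_distrr /= q_complete // eqxx mulr1 sqn_Cr.
Qed.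

Lemma form_calc a f g : form_on (calc a) Y f g =
  \sum_j (a j)%:C%C * (coef f j * (coef g j)^*).
Proof.
rewrite /form_on.
transitivity (\sum_(x <- Y) \sum_(y <- Y) \sum_j
    (a j)%:C%C * ((((q j y)^* * f y)) * (q j x * (g x)^*))).
  apply: eq_bigr => x _; apply: eq_bigr => y _.
  rewrite /calc big_distrr /= big_distrl /=; apply: eq_bigr => j _; ring.
under eq_bigr do rewrite exchange_big /=.
rewrite exchange_big /=; apply: eq_bigr => j _.
under eq_bigr do rewrite -big_distrr /= -big_distrl /=.
rewrite -big_distrr -big_distrr /=; congr (_ * (_ * _)).
rewrite /coef rmorph_sum /=; apply: eq_bigr => x _.
by rewrite rmorphM /= conjCK.
Qed.

(** In the basis q the form is diagonal: it is bounded term by term, and Parseval sums the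
    bounds. *)
Lemma calc_bound a c : 0 <= c -> (forall j, `|a j| <= c) -> form_bound (calc a) c.
Proof.
move=> c0 ac F f g uF.
rewrite (form_on_cut (Y := Y)) //; last exact: calc_supp.
apply: le_trans (_ : c * (sqs Y (restr F f) + sqs Y (restr F g)) <= _); last first.
  by rewrite ler_wpM2l // lerD // sqs_cut.
rewrite form_calc Re_sum -!coef_parseval -big_split /= !big_distrr /=.
apply: ler_sum => j _; apply: Re_le => //; rewrite ?sqn_ge0 //.
rewrite !sqnM sqnJ sqnC -mulrA ler_wpM2r ?mulr_ge0 ?sqn_ge0 //.
by rewrite -[leLHS]real_normK ?num_real // ler_sqr ?nnegrE.
Qed.

Lemma coef_q i j : coef (q i) j = (i == j)%:R.
Proof. by rewrite /coef -q_orth; apply: eq_bigr => x _; rewrite mulrC. Qed.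

Lemma calc_eigenvalue a j : (a j)%:C%C = form_on (calc a) Y (q j) (q j).
Proof.
rewrite form_calc (bigD1 j) //= big1 ?addr0; last first.
  by move=> i ij; rewrite coef_q eq_sym (negbTE ij) mul0r mulr0.
by rewrite !coef_q eqxx conjC1 !mulr1.
Qed.

Lemma calcM a b x y : \sum_(z <- Y) calc a x z * calc b z y =
  calc (fun j => a j * b j) x y.
Proof.
rewrite /calc.
transitivity (\sum_(z <- Y) \sum_i \sum_j (a i)%:C%C * (b j)%:C%C *
    (q i x * (q j y)^*) * (q j z * (q i z)^*)).
  apply: eq_bigr => z _; rewrite big_distrlr /=.
  by apply: eq_bigr => i _; apply: eq_bigr => j _; ring.
rewrite exchange_big /=; apply: eq_bigr => i _.
rewrite exchange_big /= (bigD1 i) //= [X in _ + X]big1 ?addr0; last first.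
  by move=> j ji; rewrite -big_distrr /= q_orth (negbTE ji) mulr0.
by rewrite -big_distrr /= q_orth eqxx mulr1 rmorphM.
Qed.

End Calculus.

(** * Schur multipliers and the Schur test *)

Section Schur.
Variable R : realType.
Variable X : choiceType.
Implicit Types (T S : opmat R X) (F Y : seq X) (f g : X -> R[i]).

(** A nonnegative complex number is real; for the vector (1, i) the imaginary part of the form is,
    up to sign, k x y - k y x. *)
Lemma pos_def_sym (k : X -> X -> R) x y : pos_def_kernel k -> k x y = k y x.
Proof.
move=> /(_ 2%N (fun i => if i == ord0 then x else y)
  (fun i => if i == ord0 then 1 else 'i%C)) h.
have := ger0_Im h; rewrite !big_ord_recl !big_ord0 /=.
rewrite !(mul0r, mulr0, addr0, mul1r, mulr1, add0r, oppr0, subr0, mulN1r).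
lra.
Qed.

Lemma pos_def_seq (k : X -> X -> R) F (a : X -> R[i]) : pos_def_kernel k ->
  0 <= \sum_(x <- F) \sum_(y <- F) a x * (a y)^* * (k x y)%:C%C.
Proof.
move=> /(_ (size F) (tnth (in_tuple F)) (a \o tnth (in_tuple F))) /=.
rewrite [in X in _ -> X]big_tnth; apply: eq_ind; congr (_ <= _).
by apply: eq_bigr => i _; rewrite [LHS]big_tnth.
Qed.

(** Diagonalise k on F with eigenvalues d_j >= 0. The form of the product is then the sum of d_j
    times the form of T at the vectors q_j^* f and q_j^* g, and the sum of d_j |q_j(x)|^2 is k(x,x)
    <= 1. *)
Lemma schur_multiplier (k : X -> X -> R) T c : 0 <= c -> pos_def_kernel k ->
  (forall x, k x x <= 1) -> form_bound T c ->
  form_bound (fun x y => (k x y)%:C%C * T x y) c.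
Proof.
move=> c0 pk k1 hT F f g uF.
have [n [d [q [qo qc kq q0]]]] := spectral_seq uF (fun x y => pos_def_sym x y pk).
have d0 j : 0 <= d j.
  rewrite -ler0c (calc_eigenvalue qo).
  apply: le_trans (pos_def_seq F (fun x => (q j x)^*) pk) _.
  rewrite le_eqVlt; apply/orP; left; apply/eqP; rewrite /form_on.
  rewrite !big_seq; apply: eq_bigr => x xF; rewrite !big_seq.
  by apply: eq_bigr => y yF; rewrite conjCK kq // mulrAC.
have -> : form_on (fun x y => (k x y)%:C%C * T x y) F f g =
   \sum_j (d j)%:C%C * form_on T F (fun y => (q j y)^* * f y) (fun x => (q j x)^* * g x).
  transitivity (\sum_(x <- F) \sum_(y <- F) \sum_j
     (d j)%:C%C * (((q j x)^* * g x)^* * T x y * ((q j y)^* * f y))).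
    rewrite /form_on !big_seq; apply: eq_bigr => x xF; rewrite !big_seq.
    apply: eq_bigr => y yF; rewrite kq // big_distrl big_distrr big_distrl /=.
    by apply: eq_bigr => j _; rewrite rmorphM /= conjCK; ring.
  under eq_bigr do rewrite exchange_big /=.
  rewrite exchange_big /=; apply: eq_bigr => j _.
  rewrite /form_on big_distrr /=; apply: eq_bigr => x _.
  by rewrite big_distrr.
have kd x : x \in F -> k x x = \sum_j d j * sqn (q j x).
  move=> xF; apply: complexI; rewrite kq // rmorph_sum /=.
  by apply: eq_bigr => j _; rewrite rmorphM /= sqn_Cr.
have sqk h : \sum_j d j * sqs F (fun y => (q j y)^* * h y) <= sqs F h.
  rewrite /sqs; under eq_bigr do rewrite big_distrr /=.
  rewrite exchange_big /= big_seq [leRHS]big_seq; apply: ler_sum => x xF.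
  have -> : \sum_j d j * sqn ((q j x)^* * h x) = k x x * sqn (h x).
    rewrite kd // big_distrl /=; apply: eq_bigr => j _.
    by rewrite sqnM sqnJ mulrA.
  by rewrite -[leRHS]mul1r ler_wpM2r ?sqn_ge0.
rewrite Re_sum big_distrr /=.
apply: le_trans (_ : \sum_j d j * (c * (sqs F (fun y => (q j y)^* * f y) +
   sqs F (fun x => (q j x)^* * g x))) <= _).
  apply: ler_sum => j _; rewrite ReZ mulrCA ler_wpM2l //; exact: hT.
under eq_bigr do rewrite mulrCA mulrDr.
by rewrite -big_distrr big_split /= ler_wpM2l // lerD.
Qed.

End Schur.

Section BoundedGeometry.
Variable R : realType.
Variable X : choiceType.
Variable d : X -> X -> \bar R.
Hypothesis dsym : forall x y, d x y = d y x.

Definition ball_card (r : R) (N : nat) := forall (x : X) (s : seq X),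
  uniq s -> (forall y, y \in s -> (d x y <= r%:E)%E) -> (size s <= N)%N.

Lemma ball_sum r N x (F : seq X) (c : R) : ball_card r N -> uniq F -> 0 <= c ->
  \sum_(y <- F | (d x y <= r%:E)%E) c <= N%:R * c.
Proof.
move=> hN uF c0; rewrite -big_filter big_const_seq count_predT iter_addr_0.
rewrite -[leLHS]mulr_natl ler_wpM2r // ler_nat; apply: (hN x); first exact: filter_uniq.
by move=> y; rewrite mem_filter => /andP[].
Qed.

(** The Schur test: rows have at most N nonzero entries, and so have columns because d is
    symmetric. *)
Lemma bounded_geometry_form_bound r N (T : opmat R X) h :
  ball_card r N -> prop_le d T r ->
  0 <= h -> (forall x y, sqn (T x y) <= h ^+ 2) -> form_bound T (h * N%:R).
Proof.
move=> hN pT h0 hT F f g uF; rewrite /form_on Re_sum.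
under eq_bigr do rewrite Re_sum.
apply: le_trans (_ : \sum_(x <- F) \sum_(y <- F | (d x y <= r%:E)%E)
    h * (sqn (f y) + sqn (g x)) <= _).
  rewrite big_distrr; apply: ler_sum => x _ /=.
  rewrite big_distrr /= [leRHS]big_mkcond; apply: ler_sum => y _.
  case: ifP => dxy.
    apply: Re_le; rewrite ?sqn_ge0 // !sqnM sqnJ.
    have := hT x y; have := sqn_ge0 (f y); have := sqn_ge0 (g x).
    move=> ? ? ?; rewrite [sqn (g x) * _]mulrC mulrAC.
    by rewrite ler_wpM2r // ler_wpM2r.
  have -> : T x y = 0 by apply: contraFeq dxy => /pT.
  by rewrite mulr0 mul0r mulr0.
under eq_bigr do under eq_bigr do rewrite mulrDr.
under eq_bigr do rewrite big_split /=.
rewrite big_split /= mulrDr lerD //.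
  rewrite (exchange_big_dep predT) //= /sqs big_distrr /=; apply: ler_sum => y _.
  under eq_bigl do rewrite dsym.
  apply: le_trans (ball_sum y hN uF (mulr_ge0 h0 (sqn_ge0 _))) _.
  by rewrite mulrA [_ * h]mulrC.
rewrite /sqs big_distrr /=; apply: ler_sum => x _.
apply: le_trans (ball_sum x hN uF (mulr_ge0 h0 (sqn_ge0 _))) _.
by rewrite mulrA [_ * h]mulrC.
Qed.

End BoundedGeometry.

(** * Property A makes ghosts compact *)

Section GhostsCompact.
Variable R : realType.
Variable X : choiceType.
Implicit Types (T S : opmat R X) (F Y : seq X) (f g : X -> R[i]).

Lemma form_boundW T c e : form_bound T c -> c <= e -> form_bound T e.
Proof.
move=> h ce F f g uF; apply: le_trans (h F f g uF) _.
by rewrite ler_wpM2r ?addr_ge0 ?sqs_ge0.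
Qed.

Lemma finite_support_in_l2 F f : uniq F -> (forall x, x \notin F -> f x = 0) ->
  in_l2 f.
Proof.
move=> uF f0; exists (sqs F f) => G uG; rewrite sqnorm_onE lecR /sqs.
rewrite (sum_support (Y := F)) //; last by move=> x _ /f0 ->; exact: sqn0.
rewrite [leRHS](bigID (fun x => x \in G)) /= -[leLHS]addr0 lerD //.
by apply: sumr_ge0 => x _; exact: sqn_ge0.
Qed.

Lemma finite_matrix_finite_rank F T : uniq F ->
  (forall x y, (x \notin F) || (y \notin F) -> T x y = 0) -> finite_rank T.
Proof.
move=> uF T0; pose pt := tnth (in_tuple F).
exists (size F), (fun l x => if x == pt l then 1 else 0), (fun l y => (T (pt l) y)^*).
split; [|split].
- move=> l; apply: (finite_support_in_l2 uF) => x; case: eqVneq => // ->.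
  by rewrite mem_tnth.
- by move=> l; apply: (finite_support_in_l2 uF) => x xF; rewrite T0 ?xF ?orbT ?conjC0.
move=> x y; have [/seq_tnthP[l ->]|xF] := boolP (x \in F); last first.
  rewrite T0 ?xF // big1 // => l _; case: eqVneq => [xl|_]; last exact: mul0r.
  by rewrite xl mem_tnth in xF.
rewrite (bigD1 l) //= eqxx mul1r conjCK big1 ?addr0 // => j jl.
rewrite ifN ?mul0r // eq_sym; apply: contra jl => /eqP.
rewrite /pt !(tnth_nth x) /= => /eqP.
by rewrite nth_uniq // => /eqP /val_inj ->.
Qed.

Lemma pos_def_le1 (k : X -> X -> R) x y : pos_def_kernel k ->
  (forall z, k z z <= 1) -> `|k x y| <= 1.
Proof.
move=> pk k1; have ks := pos_def_sym x y pk.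
have key (s : R) : s ^+ 2 = 1 -> 0 <= k x x + k y y + 2 * s * k x y.
  move=> s2; have := pk 2%N (fun i => if i == ord0 then x else y)
    (fun i => if i == ord0 then 1 else s%:C%C).
  have cs : (s%:C%C : R[i])^* = s%:C%C by exact: conjc_real.
  rewrite !big_ord_recl !big_ord0 /= !addr0 conjC1 cs.
  rewrite !(mul1r, mulr1) -!rmorphM -!rmorphD /= lecR -ks -expr2 s2.
  by congr (_ <= _); ring.
have h1 := key 1 (expr1n _ _).
have : 0 <= k x x + k y y + 2 * (-1) * k x y by apply: key; rewrite sqrrN expr1n.
move: (k1 x) (k1 y); rewrite ler_norml => *; apply/andP; split; lra.
Qed.

Variable d : X -> X -> \bar R.
Hypothesis hd : is_emetric d.
Hypothesis hbg : bounded_geometry d.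

Lemma dist_sym x y : d x y = d y x.
Proof. by case: hd. Qed.

Lemma dist_refl x : d x x = 0%E.
Proof. by case: hd => _ h _ _; apply/h. Qed.

Lemma property_A_ghost_compact T : property_A d -> ghost d T -> compact_op T.
Proof.
move=> [k [kpos [kprop kA]]] [[bT roeT] gT]; split=> // eps eps0.
(* Four errors of size e, from T - K = (T - S) - q (T - S) + (1 - q) S + (q T - K), where q acts as
   a Schur multiplier. *)
pose e := eps / 4; have e0 : 0 < e by rewrite divr_gt0.
have [S [[[c0 bS] [r0 [r00 pS]]] TS]] := roeT e e0.
pose c := `|c0| + 1; have cp : 0 < c by rewrite ltr_wpDl.
(* Enlarging r0 by 1 gives a positive radius and turns d <= r0 into the strict inequality required
   in property A. *)
have r1 : 0 < r0 + 1 by rewrite ltr_wpDl.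
have [N hN] := hbg r1.
(* The entries of (1 - q) S will be at most e' c, so its norm is at most e' c N <= e; N + 1 avoids
   division by zero. *)
pose e' := e / (c * (N%:R + 1)).
have N1 : 0 < N%:R + 1 :> R by rewrite ltr_wpDl.
have e'0 : 0 < e' by rewrite divr_gt0 // mulr_gt0.
have [n0 /(_ n0.+1 (ltnSn _)) kn] := kA _ _ r1 e'0.
set q := k n0.+1 in kn; have pq : pos_def_kernel q by exact: kpos.
have q1 x : q x x <= 1.
  by have := kn x x; rewrite dist_refl lte_fin => /(_ r1)/andP[].
have [r2 hr2] := kprop n0.+1; rewrite -/q in hr2.
pose r3 := Num.max r2 1; have r30 : 0 < r3 by rewrite lt_max ltr01 orbT.
have [M hM] := hbg r30.
have M1 : 0 < M%:R + 1 :> R by rewrite ltr_wpDl.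
pose h := e / (M%:R + 1); have h0 : 0 < h by rewrite divr_gt0.
have [G0 hG0] := gT h h0; pose G := undup G0.
have hG x y : (x \notin G) || (y \notin G) -> sqn (T x y) < h ^+ 2.
  by rewrite !mem_undup => /hG0; rewrite normc_lt.
(* Outside G x G the entries of T are below h = e / (M + 1), and q T has at most M of them in each
   row, so dropping them costs at most e. *)
pose K : opmat R X := fun x y =>
  if (x \in G) && (y \in G) then (q x y)%:C%C * T x y else 0.
exists K; split.
  apply: (finite_matrix_finite_rank (undup_uniq G0)) => x y.
  by rewrite -/G -negb_and /K => /negbTE ->.
apply: form_bound_bounded; first exact: ltW.
have b1 : form_bound (mat_sub T S) e by apply: bounded_form_bound_ge0 => //; exact: ltW.
have b2 := form_boundN (schur_multiplier (ltW e0) pq q1 b1).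
have b3 : form_bound (fun x y => (1 - (q x y)%:C%C) * S x y) e.
  apply: form_boundW (_ : form_bound _ (e' * c * N%:R)) _; last first.
    have -> : e' * c * N%:R = e * (N%:R / (N%:R + 1)).
      by rewrite /e'; field; rewrite !lt0r_neq0.
    by rewrite ler_piMr ?(ltW e0) // ler_pdivrMr // mul1r lerDl.
  have Sc x y : sqn (S x y) <= c ^+ 2.
    apply: le_trans (form_bound_entry x y (normr_ge0 c0) _) _.
      by move=> F f g uF; rewrite (real_normK (num_real c0)); exact: bS.
    by rewrite ler_sqr ?nnegrE ?(ltW cp) // lerDl.
  apply: (bounded_geometry_form_bound dist_sym hN).
  - move=> x y /eqP Sxy; apply: le_trans (pS x y _) _; last by rewrite lee_fin lerDl.
    by apply: contra_notN Sxy => /eqP ->; rewrite mulr0.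
  - by rewrite mulr_ge0 ?ltW.
  move=> x y; have [->|Sxy] := eqVneq (S x y) 0.
    by rewrite mulr0 sqn0 sqr_ge0.
  rewrite sqnM exprMn -(rmorph1 (real_complex R)) -rmorphB /= sqnC.
  rewrite ler_pM ?sqr_ge0 ?sqn_ge0 //.
  have : (d x y < (r0 + 1)%:E)%E.
    by apply: le_lt_trans (pS x y Sxy) _; rewrite lte_fin ltrDl.
  move=> /(kn x y)/andP[k1 k2].
  by rewrite ler_sqr ?nnegrE ?(ltW e'0) ?subr_ge0 // lerBlDl -lerBlDr.
have b4 : form_bound (fun x y => (q x y)%:C%C * T x y - K x y) e.
  apply: form_boundW (_ : form_bound _ (h * M%:R)) _; last first.
    rewrite /h mulrAC -mulrA ler_piMr ?(ltW e0) // ler_pdivrMr //.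
    by rewrite mul1r lerDl.
  apply: (bounded_geometry_form_bound dist_sym hM); last 2 first.
  - exact: ltW.
  - move=> x y; rewrite /K; case: ifPn => [_|]; first by rewrite subrr sqn0 sqr_ge0.
    rewrite negb_and => /hG Txy; rewrite subr0 sqnM sqnC.
    rewrite -[leRHS]mul1r ler_pM ?sqr_ge0 ?sqn_ge0 ?(ltW Txy) //.
    by rewrite -real_normK ?num_real // expr_le1 ?pos_def_le1.
  move=> x y; apply: contraNT; rewrite -ltNge => dxy; rewrite /K hr2.
    by rewrite mul0r if_same subr0.
  by apply: le_lt_trans dxy; rewrite lee_fin le_max lexx.
have := form_boundD (form_boundD b1 b2) (form_boundD b3 b4).
have -> : e + e + (e + e) = eps by rewrite /e; field.
apply: eq_form_bound => x y; rewrite /mat_sub; ring.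
Qed.

End GhostsCompact.

(** * Positive definite kernels of finite propagation *)

Section RealKernels.
Variable R : realType.
Variable X : choiceType.
Implicit Types (k h : X -> X -> R) (f : X -> R).

(** With real coefficients symmetry does not follow from positivity, so it is required
    separately. *)
Definition psd k := (forall x y, k x y = k y x) /\
  forall (m : nat) (p : 'I_m -> X) (a : 'I_m -> R),
    0 <= \sum_(i < m) \sum_(j < m) a i * a j * k (p i) (p j).

(** For lam = a + i b the real part of the form is the sum of the forms at a and at b; the imaginary
    part is an antisymmetric sum, which vanishes since k is symmetric. *)
Lemma psd_pos_def k : psd k -> pos_def_kernel k.
Proof.
move=> [ks kp] m p lam.
pose a i := complex.Re (lam i); pose b i := complex.Im (lam i).
pose re i j := (a i * a j + b i * b j) * k (p i) (p j).
pose im i j := (b i * a j - a i * b j) * k (p i) (p j).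
have im0 : \sum_i \sum_j im i j = 0.
  have : \sum_i \sum_j im i j = - \sum_i \sum_j im i j.
    rewrite {1}exchange_big /= -sumrN; apply: eq_bigr => i _.
    rewrite -sumrN; apply: eq_bigr => j _.
    by rewrite /im (ks (p j)); ring.
  lra.
have -> : \sum_i \sum_j lam i * (lam j)^* * (k (p i) (p j))%:C%C
        = (\sum_i \sum_j re i j)%:C%C + 'i%C * (\sum_i \sum_j im i j)%:C%C.
  rewrite !rmorph_sum /= big_distrr -big_split /=; apply: eq_bigr => i _.
  rewrite !rmorph_sum /= big_distrr -big_split /=; apply: eq_bigr => j _.
  rewrite /re /im /a /b; case: (lam i) => u v; case: (lam j) => u' v'.
  by apply/eqP; rewrite eq_complex /=; apply/andP; split; apply/eqP; ring.
rewrite im0 rmorph0 mulr0 addr0 ler0c.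
have -> : \sum_i \sum_j re i j = \sum_i \sum_j a i * a j * k (p i) (p j)
                               + \sum_i \sum_j b i * b j * k (p i) (p j).
  rewrite -big_split /=; apply: eq_bigr => i _; rewrite -big_split /=.
  by apply: eq_bigr => j _; rewrite /re mulrDl.
by rewrite addr_ge0.
Qed.

Lemma psd0 : psd (fun _ _ => 0).
Proof.
split=> // m p a; apply: sumr_ge0 => i _; apply: sumr_ge0 => j _.
by rewrite mulr0.
Qed.

Lemma psdD k h : psd k -> psd h -> psd (fun x y => k x y + h x y).
Proof.
move=> [ks kp] [hs hp]; split=> [x y|m p a]; first by rewrite ks hs.
have := addr_ge0 (kp m p a) (hp m p a); rewrite -big_split /=.
congr (_ <= _); apply: eq_bigr => i _; rewrite -big_split /=.
by apply: eq_bigr => j _; rewrite mulrDr.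
Qed.

Lemma psdM f k : psd k -> psd (fun x y => f x * f y * k x y).
Proof.
move=> [ks kp]; split=> [x y|m p a]; first by rewrite ks; ring.
have := kp m p (fun i => a i * f (p i)).
congr (_ <= _); apply: eq_bigr => i _; apply: eq_bigr => j _; ring.
Qed.

Lemma psd1 : psd (fun _ _ => 1).
Proof.
split=> // m p a; under eq_bigr do under eq_bigr do rewrite mulr1.
under eq_bigr do rewrite -big_distrr /=.
by rewrite -big_distrl /= -expr2 sqr_ge0.
Qed.

Lemma psd_rank1 f : psd (fun x y => f x * f y).
Proof.
have := psdM f psd1; congr psd.
by apply/funext => x; apply/funext => y; rewrite mulr1.
Qed.

Lemma psdZ (t : R) k : 0 <= t -> psd k -> psd (fun x y => t * k x y).
Proof.
move=> t0 pk; have := psdM (fun=> Num.sqrt t) pk; congr psd.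
by apply/funext => x; apply/funext => y; rewrite -expr2 sqr_sqrtr.
Qed.

(** Positivity at the vectors (1, 1) and (1, -1). *)
Lemma psd_abs_le k x y : psd k -> 2 * `|k x y| <= k x x + k y y.
Proof.
move=> [ks kp].
have key (s : R) : s ^+ 2 = 1 -> 0 <= k x x + k y y + 2 * s * k x y.
  move=> s2; have := kp 2%N (fun i => if i == ord0 then x else y)
    (fun i => if i == ord0 then 1 else s).
  rewrite !big_ord_recl !big_ord0 /= !addr0 (ks y x).
  rewrite !(mul1r, mulr1) -expr2 s2.
  by congr (_ <= _); ring.
have h1 := key 1 (expr1n _ _).
have : 0 <= k x x + k y y + 2 * (-1) * k x y by apply: key; rewrite sqrrN expr1n.
move=> h2; rewrite -ler_pdivlMl //; rewrite ler_norml; apply/andP; split; lra.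
Qed.

End RealKernels.

Section Approximation.
Variable R : realType.
Variable X : choiceType.
Variable d : X -> X -> \bar R.
Hypothesis hd : is_emetric d.
Implicit Types (k h : X -> X -> R) (Y : pred X).

Definition kernel_prop k (S : R) := forall x y, (S%:E < d x y)%E -> k x y = 0.

(** One term of a property A sequence, at scale r and precision e. Only the lower bound is localised
    to Y; the other conditions hold on all of X. *)
Definition good_kernel Y (r e S : R) := exists k, [/\ psd k, kernel_prop k S,
  forall x, k x x <= 1 &
  forall x y, Y x -> Y y -> (d x y <= r%:E)%E -> 1 - e <= k x y].

Lemma good_property_A :
  (forall r e : R, 0 < r -> 0 < e -> exists S, good_kernel xpredT r e S) -> property_A d.
Proof.
move=> H.
have /choice[k hk] : forall n : nat, exists k : X -> X -> R, exists S : R,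
   [/\ psd k, kernel_prop k S, forall x, k x x <= 1 &
   forall x y, (d x y <= n.+1%:R%:E)%E -> 1 - n.+1%:R^-1 <= k x y].
  move=> n; have n0 : 0 < n.+1%:R^-1 :> R by rewrite invr_gt0.
  have [S [k [k1 k2 k3 k4]]] := H n.+1%:R n.+1%:R^-1 (ltr0Sn _ _) n0.
  by exists k, S; split=> // x y; exact: k4.
exists k; split; [|split].
- by move=> n; have [S [pk _ _ _]] := hk n; exact: psd_pos_def.
- by move=> n; have [S [_ pk _ _]] := hk n; exists S.
move=> s eps s0 eps0; exists (maxn (Num.truncn s) (Num.truncn eps^-1)) => n.
rewrite gtn_max => /andP[ns ne] x y dxy.
have [S [pk _ k1 kn]] := hk n; apply/andP; split.
  apply: le_trans (kn x y _); last first.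
    apply: (le_trans (ltW dxy)); rewrite lee_fin; apply: le_trans (ltW (truncnS_gt s)) _.
    by rewrite ler_nat ltnS ltnW.
  rewrite lerD2l lerN2 -[leRHS]invrK lef_pV2 ?posrE ?invr_gt0 //.
  apply: le_trans (ltW (truncnS_gt _)) _.
  by rewrite ler_nat ltnS ltnW.
have := psd_abs_le x y pk; have := k1 x; have := k1 y; have := ler_norm (k n x y).
lra.
Qed.

(** Because |sqrt a - sqrt b| <= sqrt a + sqrt b. *)
Lemma sqrt_sub_sqr (a b : R) : 0 <= a -> 0 <= b ->
  (Num.sqrt a - Num.sqrt b) ^+ 2 <= `|a - b|.
Proof.
move=> a0 b0; have := sqr_sqrtr a0; have := sqr_sqrtr b0.
move: (sqrtr_ge0 a) (sqrtr_ge0 b); set u := Num.sqrt a; set v := Num.sqrt b.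
move=> u0 v0 <- <-; rewrite ler_normr; apply/orP.
by have [uv|/ltW uv] := leP u v; [right|left]; nra.
Qed.

(** A tent of height 1 and slope 1/L. The test matters at infinite distance: [fine] maps +oo to 0,
    and the formula alone would give 1 there. *)
Definition bump (x0 : X) (L : R) x : R :=
  if (d x x0 <= L%:E)%E then 1 - fine (d x x0) / L else 0.

Lemma dist_fin x y (L : R) : (d x y <= L%:E)%E -> d x y = (fine (d x y))%:E.
Proof.
case: hd => d0 _ _ _; have := d0 x y; case: (d x y) => //=.
Qed.

Lemma bump01 x0 L x : 0 < L -> 0 <= bump x0 L x <= 1.
Proof.
move=> L0; rewrite /bump; case: ifP => [h|_]; last by rewrite lexx ler01.
have dE := dist_fin h; rewrite dE lee_fin in h.
have d0 : 0 <= fine (d x x0) by rewrite -lee_fin -dE; case: hd.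
rewrite subr_ge0 ler_pdivrMr // mul1r h /= gerBl divr_ge0 //; exact: ltW.
Qed.

Lemma bump_lipschitz1 x0 L r x y : 0 < L -> 0 <= r -> (d x y <= r%:E)%E ->
  bump x0 L x - bump x0 L y <= r / L.
Proof.
move=> L0 r0 hxy; have /andP[b0 _] := bump01 x0 y L0.
rewrite {1}/bump; case: ifP => [hx|_]; last first.
  by rewrite sub0r; apply: le_trans (_ : 0 <= _); rewrite ?oppr_le0 // divr_ge0 // ltW.
have tri : (d y x0 <= d x y + d x x0)%E.
  by have := dist_sym hd x y => ->; case: hd.
have Ex := dist_fin hx; have Exy := dist_fin hxy; rewrite Ex Exy -EFinD in tri.
have Ey := dist_fin tri; rewrite Ey lee_fin in tri.
rewrite Exy lee_fin in hxy.
(* The formula 1 - d(y,x0)/L bounds the tent at y from below even outside its support, where it is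
   negative. *)
apply: le_trans (_ : 1 - fine (d x x0) / L - (1 - fine (d y x0) / L) <= _); last first.
  have -> : 1 - fine (d x x0) / L - (1 - fine (d y x0) / L)
          = (fine (d y x0) - fine (d x x0)) / L by ring.
  by rewrite ler_wpM2r ?invr_ge0 ?(ltW L0) // lerBlDr; apply: (le_trans tri); rewrite lerD2r.
rewrite lerD2l lerN2 /bump; case: ifPn => // hy.
rewrite subr_le0 ler_pdivlMr // mul1r -lee_fin -Ey ltW //.
by rewrite ltNge.
Qed.

Lemma bump_lipschitz x0 L r x y : 0 < L -> 0 <= r -> (d x y <= r%:E)%E ->
  `|bump x0 L x - bump x0 L y| <= r / L.
Proof.
move=> L0 r0 h; rewrite ler_norml; apply/andP; split; last exact: bump_lipschitz1.
by rewrite -lerN2 opprK opprB bump_lipschitz1 // (dist_sym hd).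
Qed.

(* With a^2 + b^2 = 1, a = 1 at x0 and a, b almost constant at scale r, the
   kernel a(x)a(y) + b(x)b(y)k(x,y) is unaffected by the values of k at x0. *)
Lemma good_kernel_add_point Y x0 (r e e' S : R) : 0 < r -> e' < e -> 0 <= e' ->
  good_kernel [pred x | Y x && (x != x0)] r e' S ->
  good_kernel Y r e (Num.max S (2 * (r / (e - e')))).
Proof.
move=> r0 ee e'0 [k [pk Sk k1 kY]].
have ep : 0 < e - e' by rewrite subr_gt0.
(* The tent of width L varies by at most r / L = e - e' at scale r, which is the precision that may
   be lost. *)
pose L := r / (e - e'); have L0 : 0 < L by rewrite divr_gt0.
have rL : r / L = e - e' by rewrite /L invf_div mulrCA divff ?mulr1 ?lt0r_neq0.
pose phi := bump x0 L.
have phi01 x : 0 <= phi x <= 1 by exact: bump01.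
have phi0 x : 0 <= phi x by case/andP: (phi01 x).
have phi1 x : 0 <= 1 - phi x by rewrite subr_ge0; case/andP: (phi01 x).
pose a x := Num.sqrt (phi x); pose b x := Num.sqrt (1 - phi x).
have ab x : a x ^+ 2 + b x ^+ 2 = 1 by rewrite !sqr_sqrtr // addrC subrK.
exists (fun x y => a x * a y + b x * b y * k x y); split.
- by apply: psdD; [exact: psd_rank1|exact: psdM].
- move=> x y hxy; rewrite Sk ?mulr0 ?addr0; last first.
    by apply: le_lt_trans hxy; rewrite lee_fin le_max lexx.
  have [ax|ax] := eqVneq (phi x) 0; first by rewrite /a ax sqrtr0 mul0r.
  have [ay|ay] := eqVneq (phi y) 0; first by rewrite /a ay sqrtr0 mulr0.
  exfalso; move: hxy; apply/negP; rewrite -leNgt.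
  have near z : phi z != 0 -> (d z x0 <= L%:E)%E.
    by rewrite /phi /bump; case: ifP => //; rewrite eqxx.
  have tri : (d x y <= d x x0 + d y x0)%E.
    by have := dist_sym hd y x0 => ->; case: hd.
  apply: le_trans tri _; apply: le_trans (leeD (near _ ax) (near _ ay)) _.
  by rewrite -EFinD lee_fin le_max; apply/orP; right; rewrite mulr2n mulrDl !mul1r.
- move=> x; have := ab x; have := k1 x; have := sqr_ge0 (b x); nra.
move=> x y Yx Yy hxy.
(* As a^2 + b^2 = 1, the right side is 1 - ((a x - a y)^2 + (b x - b y)^2) / 2, and both squares are
   at most |phi x - phi y| <= e - e'. *)
have h1 : 1 - (e - e') <= a x * a y + b x * b y.
  have h := bump_lipschitz x0 L0 (ltW r0) hxy; rewrite rL -/phi in h.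
  have := sqrt_sub_sqr (phi0 x) (phi0 y).
  have := sqrt_sub_sqr (phi1 x) (phi1 y).
  have -> : 1 - phi x - (1 - phi y) = - (phi x - phi y) by ring.
  rewrite normrN -/(a x) -/(a y) -/(b x) -/(b y).
  have := ab x; have := ab y; nra.
have phix0 : phi x0 = 1.
  by rewrite /phi /bump (dist_refl hd) lee_fin (ltW L0) mul0r subr0.
have bx0 : b x0 = 0 by rewrite /b phix0 subrr sqrtr0.
have [x0E|xx0] := eqVneq x x0.
  by move: h1; rewrite x0E bx0 !mul0r !addr0; lra.
have [y0E|yx0] := eqVneq y x0.
  by move: h1; rewrite y0E bx0 !mulr0 !mul0r !addr0; lra.
have k2 : 1 - e' <= k x y by apply: kY => //=; rewrite ?Yx ?Yy.
have bxy : 0 <= b x * b y by rewrite mulr_ge0 ?sqrtr_ge0.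
have bxy1 : b x * b y <= 1.
  have := ab x; have := ab y; have := sqr_ge0 (a x); have := sqr_ge0 (a y).
  have := sqr_ge0 (b x - b y); nra.
nra.
Qed.

(** Points are put back one at a time, each costing half of the remaining gap between e' and e, so
    finitely many never exhaust it. *)
Lemma good_kernel_add_seq (F : seq X) Y (r e e' S : R) : 0 < r -> e' < e -> 0 <= e' ->
  good_kernel [pred x | Y x && (x \notin F)] r e' S -> exists S', good_kernel Y r e S'.
Proof.
move=> r0; elim: F Y e' S => [|x F IH] Y e' S ee e'0 H.
  exists S; case: H => k [k1 k2 k3 k4].
  have [e''0|] := leP e' e; last by rewrite ltNge (ltW ee).
  by exists k; split=> // u v Yu Yv uv; apply: le_trans (k4 u v _ _ uv);
     rewrite ?lerD2l ?lerN2 //= ?Yu ?Yv.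
pose e1 := (e' + e) / 2.
have e'1 : e' < e1 by rewrite /e1; lra.
have e1e : e1 < e by rewrite /e1; lra.
have H1 : good_kernel [pred y | (Y y && (y \notin F)) && (y != x)] r e' S.
  case: H => k [k1 k2 k3 k4]; exists k; split=> // u v.
  move=> /andP[/andP[Yu uF] ux] /andP[/andP[Yv vF] vx]; apply: k4;
  by rewrite /= ?Yu ?Yv inE negb_or ?ux ?vx.
apply: (IH Y e1 _ _ _ (good_kernel_add_point r0 e'1 e'0 H1)) => //.
exact: le_trans (ltW e'1).
Qed.

End Approximation.

(** * Limits along an ultrafilter *)

Section Ultralimits.
Local Open Scope classical_set_scope.
Variable R : realType.
Variables (I : Type) (U : set_system I).
Context (UU : UltraFilter U).

(** A cluster point exists by compactness of [-B, B], and an ultrafilter converges to its cluster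
    points. Thus all entries of a bounded family of kernels converge at once, without diagonal
    subsequences. *)
Lemma ultra_bounded_cvg (u : I -> R) (B : R) : (\near U, `|u U| <= B) ->
  u @ U --> lim (u @ U).
Proof.
move=> hB; have hU : (u @ U) `[- B, B].
  by rewrite /fmap /=; apply: filterS hB => i; rewrite /= in_itv /= -ler_norml.
have [l [_ cl]] := segment_compact _ hU.
suff h : u @ U --> l by rewrite (cvg_lim _ h).
move=> A nA; have [//|nAU] := in_ultra_setVsetC (u @^-1` A) UU.
by have [z [nAz Az]] := cl (~` A) A nAU nA; case: (nAz Az).
Qed.

Lemma cvg_sum_seq (J : Type) (s : seq J) (f : J -> I -> R) (l : J -> R) :
  (forall j, f j @ U --> l j) ->
  \sum_(j <- s) f j i @[i --> U] --> \sum_(j <- s) l j.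
Proof.
move=> h; elim: s => [|j s IH].
  by under eq_fun do rewrite big_nil; rewrite big_nil; exact: cvg_cst.
under eq_fun do rewrite big_cons; rewrite big_cons.
exact: (cvgD (h j) IH).
Qed.

Variable X : choiceType.

Lemma psd_limit (k : I -> X -> X -> R) (l : X -> X -> R) :
  (forall i, psd (k i)) -> (forall x y, k i x y @[i --> U] --> l x y) -> psd l.
Proof.
move=> kp kl; split=> [x y|m p a].
  have := kl x y; have -> : (fun i => k i x y) = (fun i => k i y x).
    by apply/funext => i; case: (kp i).
  by move=> h; apply: (cvg_unique _ h (kl y x)).
have h : \sum_(i < m) \sum_(j < m) a i * a j * k t (p i) (p j) @[t --> U] -->
   \sum_(i < m) \sum_(j < m) a i * a j * l (p i) (p j).
  apply: cvg_sum_seq => i; apply: cvg_sum_seq => j.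
  by apply: cvgM; [exact: cvg_cst|exact: kl].
apply: (cvgr_to_ge h); apply: nearW => t; exact: (kp t).2.
Qed.

End Ultralimits.

Section Compactness.
Local Open Scope classical_set_scope.
Variable R : realType.
Variable X : choiceType.
Variable d : X -> X -> \bar R.

(** Choose a kernel for each finite set and take the limit along an ultrafilter for which every
    finite set is eventually contained in Y. All the conditions are closed, and each lower bound
    holds from some finite set on. *)
Lemma good_kernel_compact (Z : pred X) (r e S : R) :
  (forall Y : seq X, uniq Y -> {subset Y <= Z} -> good_kernel d (mem Y) r e S) ->
  good_kernel d Z r e S.
Proof.
move=> H.
have /choice[k hk] : forall Y : seq X, exists k : X -> X -> R,
  [/\ psd k, kernel_prop d k S, forall x, k x x <= 1 &
   forall x y, x \in Y -> y \in Y -> Z x -> Z y -> (d x y <= r%:E)%E -> 1 - e <= k x y].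
  move=> Y; have [||k [k1 k2 k3 k4]] := H (undup (seq.filter Z Y)).
  - exact: undup_uniq.
  - by move=> x; rewrite mem_undup mem_filter => /andP[].
  exists k; split=> // x y xY yY Zx Zy; apply: k4;
  by rewrite /= mem_undup mem_filter ?Zx ?Zy.
pose above (Y : seq X) : set (seq X) := [set Y' : seq X | {subset Y <= Y'}].
pose F0 := filter_from setT above.
have F0f : ProperFilter F0.
  apply: filter_from_proper; last by move=> Y _; exists Y => /= x.
  apply: filter_fromT_filter; first by exists [::].
  move=> Y1 Y2; exists (Y1 ++ Y2) => Y /= h; split=> x hx; apply: h;
  by rewrite mem_cat hx ?orbT.
have [U [UU FU]] := ultraFilterLemma F0f.
have kc x y : k Y x y @[Y --> U] --> lim (k Y x y @[Y --> U]).
  apply: (ultra_bounded_cvg UU (B := 1)); apply: nearW => Y.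
  have [pk _ k1 _] := hk Y; have := psd_abs_le x y pk.
  have := k1 x; have := k1 y; lra.
exists (fun x y => lim (k Y x y @[Y --> U])); split.
- by apply: (psd_limit UU (k := k)) => // Y; have [] := hk Y.
- move=> x y hxy; have -> : (fun Y => k Y x y) = (fun=> 0).
    by apply/funext => Y; have [_ h _ _] := hk Y; exact: h.
  by rewrite lim_cst.
- move=> x; apply: (cvgr_to_le (kc x x)); apply: nearW => Y.
  by have [_ _ h _] := hk Y.
move=> x y Zx Zy hxy; apply: (cvgr_to_ge (kc x y)).
have : U (above [:: x; y]) by apply: FU; exists [:: x; y].
apply: filterS => Y h; have [_ _ _ hY] := hk Y.
by apply: hY => //; apply: h; rewrite !inE eqxx ?orbT.
Qed.

End Compactness.

Section BadBlocks.
Local Open Scope classical_set_scope.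
Variable R : realType.
Variable X : choiceType.
Variable d : X -> X -> \bar R.
Hypothesis hd : is_emetric d.

(** Half of e is kept for putting F back: if kernels of precision e/2 existed on all finite sets off
    F, compactness would give one off F, hence one of precision e on X. *)
Lemma not_property_A_bad : ~ property_A d -> exists r e : R, [/\ 0 < r, 0 < e &
  forall (F : seq X) (S : R), exists Y : seq X,
    [/\ uniq Y, forall x, x \in Y -> x \notin F & ~ good_kernel d (mem Y) r e S]].
Proof.
move=> nA.
have [r [e [r0 e0 bad]]] : exists r e : R, [/\ 0 < r, 0 < e &
    forall S, ~ good_kernel d xpredT r e S].
  apply: contrapT => H; apply: nA; apply: good_property_A => // r e r0 e0.
  apply: contrapT => H'; apply: H; exists r, e; split=> // S gS.
  by apply: H'; exists S.
exists r, (e / 2); split=> //; first by rewrite divr_gt0.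
move=> F S; apply: contrapT => H.
have [||||S' gS'] := good_kernel_add_seq hd (F := F) (Y := xpredT) (r := r)
  (e := e) (e' := e / 2) (S := S) => //.
- lra.
- lra.
- apply: good_kernel_compact => Y uY YF; apply: contrapT => nY.
  by apply: H; exists Y; split=> // x /YF /=.
exact: (bad S').
Qed.

End BadBlocks.

(** * Duality on finite sets *)

Section PositivePart.
Local Open Scope classical_set_scope.
Variable R : realType.
Implicit Types u v : R.

(** Written through |u| because |u| is what will be approximated by polynomials. *)
Definition pospart u : R := (u + `|u|) / 2.

Lemma pospart_ge0 u : 0 <= pospart u.
Proof. by rewrite /pospart; have := ler_norm (- u); rewrite normrN; lra. Qed.

Lemma pospart_ge u : u <= pospart u.
Proof. by rewrite /pospart; have := ler_norm u; lra. Qed.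

Lemma pospart_mul u : pospart u * u = pospart u ^+ 2.
Proof.
rewrite /pospart; have [u0|u0] := ger0P u; last by rewrite addrN mul0r mul0r expr0n.
by field.
Qed.

(** The square of the positive part has derivative 2 u_+, which is 2-Lipschitz; this is its Taylor
    bound. *)
Lemma pospart_sqrD u v :
  pospart (u + v) ^+ 2 <= pospart u ^+ 2 + 2 * pospart u * v + v ^+ 2.
Proof.
by rewrite /pospart; case: (ger0P u) => u0; case: (ger0P (u + v)) => uv; nra.
Qed.

Lemma pospart_cvg (I : Type) (U : set_system I) (FU : Filter U) (f : I -> R) (a : R) :
  f @ U --> a -> pospart (f i) @[i --> U] --> pospart a.
Proof.
by move=> h; apply: cvgM; [apply: cvgD => //; exact: cvg_norm|exact: cvg_cst].
Qed.

Lemma first_order_ge0 (D C : R) : 0 <= C ->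
  (forall t : R, 0 < t -> t <= 1 -> 0 <= 2 * t * D + t ^+ 2 * C) -> 0 <= D.
Proof.
move=> C0 h; rewrite leNgt; apply/negP => D0.
have q : 0 < C + 1 - D by lra.
(* This t lies in (0, 1] and satisfies t C < -D, so that 2 D + t C < 0. *)
have := h (- D / (C + 1 - D)).
rewrite divr_gt0 ?oppr_gt0 // ler_pdivrMr // mul1r => /(_ isT).
have -> : (- D <= C + 1 - D) = true by lra.
move=> /(_ isT); set t := - D / _.
have t0 : 0 < t by rewrite divr_gt0 ?oppr_gt0.
have tE : t * (C + 1 - D) = - D by rewrite /t divfK // lt0r_neq0.
nra.
Qed.

End PositivePart.

Section Duality.
Local Open Scope classical_set_scope.
Variable R : realType.
Variable X : choiceType.
Variable d : X -> X -> \bar R.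
Variables (Y : seq X) (r e S : R).
Implicit Types k h : X -> X -> R.
Hypothesis dsym : forall x y, d x y = d y x.

Definition cone k := psd k /\ kernel_prop d k S.

Definition near_pair x y := [&& x \in Y, y \in Y & (d x y <= r%:E)%E].

Definition defect k x y := if near_pair x y then pospart (1 - e - k x y) else 0.

Definition excess k x := pospart (k x x - 1).

(** For k in the cone it vanishes exactly when [cut_kernel k] witnesses [good_kernel] on Y. At a
    minimiser its partial derivatives provide the dual weights. *)
Definition penalty k := \sum_(x <- Y) \sum_(y <- Y) defect k x y ^+ 2
  + \sum_(x <- Y) excess k x ^+ 2.

Lemma defect_ge0 k x y : 0 <= defect k x y.
Proof. by rewrite /defect; case: ifP => // _; exact: pospart_ge0. Qed.

Lemma penalty_ge0 k : 0 <= penalty k.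
Proof.
by apply: addr_ge0; apply: sumr_ge0 => x _; [apply: sumr_ge0 => y _|]; exact: sqr_ge0.
Qed.

(** Cutting to Y x Y keeps the penalty, while the penalty then controls every entry; this makes
    minimising sequences bounded. *)
Definition cut_kernel k x y := (x \in Y)%:R * (y \in Y)%:R * k x y.

Lemma cut_kernelE k x y : x \in Y -> y \in Y -> cut_kernel k x y = k x y.
Proof. by rewrite /cut_kernel => -> ->; rewrite !mul1r. Qed.

Lemma cut_kernel_cone k : cone k -> cone (cut_kernel k).
Proof.
move=> [pk Sk]; split; first exact: (psdM (fun x => (x \in Y)%:R) pk).
by move=> x y /Sk; rewrite /cut_kernel => ->; rewrite mulr0.
Qed.

Lemma penalty_cut k : penalty (cut_kernel k) = penalty k.
Proof.
congr (_ + _).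
  apply: eq_bigr => x _; apply: eq_bigr => y _; rewrite /defect /near_pair.
  by case: ifP => // /and3P[xY yY _]; rewrite cut_kernelE.
by rewrite !big_seq; apply: eq_bigr => x xY; rewrite /excess cut_kernelE.
Qed.

(** From u <= u_+ <= 1 + u_+^2 with u = k(x,x) - 1. *)
Lemma penalty_diag k x : x \in Y -> k x x <= 2 + penalty k.
Proof.
move=> xY; have : excess k x ^+ 2 <= penalty k.
  have : excess k x ^+ 2 <= \sum_(x <- Y) excess k x ^+ 2.
    rewrite (big_rem x) //= lerDl sumr_ge0 // => y _; exact: sqr_ge0.
  move=> h; apply: (le_trans h); rewrite lerDr sumr_ge0 // => z _.
  by apply: sumr_ge0 => y _; exact: sqr_ge0.
have := pospart_ge (k x x - 1); rewrite -/(excess k x); nra.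
Qed.

Lemma penalty_cut_bound k x y : cone k -> `|cut_kernel k x y| <= 2 + penalty k.
Proof.
move=> [pk _]; have B : 0 <= 2 + penalty k by have := penalty_ge0 k; lra.
rewrite /cut_kernel; case: (boolP (x \in Y)) => xY; last by rewrite !mul0r normr0.
case: (boolP (y \in Y)) => yY; last by rewrite mulr0 mul0r normr0.
rewrite !mul1r; have := psd_abs_le x y pk.
have := penalty_diag k xY; have := penalty_diag k yY; lra.
Qed.

(** A minimising sequence, cut to Y, has bounded entries and hence an ultralimit; the cone is closed
    and the penalty is continuous in the finitely many entries it involves. *)
Lemma penalty_minimizer : exists2 k, cone k & forall h, cone h -> penalty k <= penalty h.
Proof.
pose A : set R := [set penalty k | k in [set k | cone k]].
have Ainf : has_inf A.
  split; first by exists (penalty (fun _ _ => 0)), (fun _ _ => 0) => //; split=> //; exact: psd0.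
  by exists 0 => _ [k _ <-]; exact: penalty_ge0.
have /choice[k hk] : forall n : nat, exists k, cone k /\ penalty k < inf A + n.+1%:R^-1.
  move=> n; have n0 : 0 < n.+1%:R^-1 :> R by rewrite invr_gt0.
  by have [_ [k ck <-] lk] := inf_adherent n0 Ainf; exists k.
have [U [UU FU]] := ultraFilterLemma (F := \oo) _.
have kc x y : cut_kernel (k n) x y @[n --> U] --> lim (cut_kernel (k n) x y @[n --> U]).
  apply: (ultra_bounded_cvg UU (B := 2 + (inf A + 1))); apply: nearW => n.
  have [ck lk] := hk n; apply: le_trans (penalty_cut_bound x y ck) _.
  rewrite lerD2l; apply: le_trans (ltW lk) _.
  by rewrite lerD2l invf_le1 // ler1n.
set l := fun x y => lim (cut_kernel (k n) x y @[n --> U]).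
have cl : cone l.
  split; first by apply: (psd_limit UU (k := fun n => cut_kernel (k n))) => // n;
    have [/cut_kernel_cone[]] := hk n.
  move=> x y hxy; rewrite /l; have -> : (fun n => cut_kernel (k n) x y) = (fun=> 0).
    by apply/funext => n; have [/cut_kernel_cone[_]] := hk n; move=> /(_ _ _ hxy).
  by rewrite lim_cst.
exists l => // h ch.
have pl : penalty (cut_kernel (k n)) @[n --> U] --> penalty l.
  apply: cvgD.
    apply: cvg_sum_seq => x; apply: cvg_sum_seq => y; rewrite /defect.
    case: ifP => _; last by rewrite expr0n; exact: cvg_cst.
    apply: cvgM; apply: pospart_cvg; apply: cvgB; (try exact: kc); exact: cvg_cst.
  apply: cvg_sum_seq => x.
  apply: cvgM; apply: pospart_cvg; apply: cvgB; (try exact: kc); exact: cvg_cst.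
have inv : (n.+1%:R^-1 : R) @[n --> U] --> (0 : R).
  by apply: cvg_trans (@cvg_harmonic R); apply: cvg_app.
have h0 : inf A <= penalty h by apply: inf_lbound; [case: Ainf|exists h].
apply: le_trans h0.
have iA : inf A + n.+1%:R^-1 @[n --> U] --> inf A + 0.
  by apply: cvgD => //; exact: cvg_cst.
rewrite addr0 in iA; apply: (ler_cvg_to pl iA); apply: nearW => n.
by rewrite penalty_cut ltW //; case: (hk n).
Qed.

Lemma penalty_expansion k h (t : R) :
  penalty (fun x y => k x y + t * h x y) <= penalty k
  + 2 * t * (\sum_(x <- Y) excess k x * h x x
             - \sum_(x <- Y) \sum_(y <- Y) defect k x y * h x y)
  + t ^+ 2 * (\sum_(x <- Y) \sum_(y <- Y) h x y ^+ 2 + \sum_(x <- Y) h x x ^+ 2).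
Proof.
have e1 : \sum_(x <- Y) excess (fun x y => k x y + t * h x y) x ^+ 2 <=
   \sum_(x <- Y) excess k x ^+ 2 + 2 * t * \sum_(x <- Y) excess k x * h x x
   + t ^+ 2 * \sum_(x <- Y) h x x ^+ 2.
  rewrite !big_distrr -!big_split /=; apply: ler_sum => x _.
  have := pospart_sqrD (k x x - 1) (t * h x x); rewrite /excess.
  have -> : k x x + t * h x x - 1 = k x x - 1 + t * h x x by ring.
  rewrite exprMn; lra.
have e2 : \sum_(x <- Y) \sum_(y <- Y) defect (fun x y => k x y + t * h x y) x y ^+ 2 <=
   \sum_(x <- Y) \sum_(y <- Y) defect k x y ^+ 2
   - 2 * t * \sum_(x <- Y) \sum_(y <- Y) defect k x y * h x y
   + t ^+ 2 * \sum_(x <- Y) \sum_(y <- Y) h x y ^+ 2.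
  rewrite !big_distrr -sumrN -!big_split /=; apply: ler_sum => x _.
  rewrite !big_distrr -sumrN -!big_split /=; apply: ler_sum => y _.
  rewrite /defect; case: ifP => _; last first.
    by rewrite expr0n mul0r mulr0 subr0 add0r mulr_ge0 ?sqr_ge0.
  have := pospart_sqrD (1 - e - k x y) (- (t * h x y)).
  have -> : 1 - e - (k x y + t * h x y) = 1 - e - k x y - t * h x y by ring.
  rewrite sqrrN exprMn; lra.
rewrite /penalty; lra.
Qed.

(** The weights are w = [defect k] and mu = [excess k] for a minimiser k. The inequality on the cone
    is the first-order condition in the direction h. *)
Lemma good_or_dual : ~ good_kernel d (mem Y) r e S ->
  exists (w : X -> X -> R) (mu : X -> R),
  [/\ forall x y, w x y = w y x,
      forall x y, 0 <= w x y /\ (w x y != 0 -> near_pair x y),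
      forall x, 0 <= mu x,
      forall h, cone h ->
        \sum_(x <- Y) \sum_(y <- Y) w x y * h x y <= \sum_(x <- Y) mu x * h x x &
      \sum_(x <- Y) mu x <= (1 - e) * (\sum_(x <- Y) \sum_(y <- Y) w x y)
      /\ 0 < \sum_(x <- Y) \sum_(y <- Y) w x y].
Proof.
move=> bad; have [k ck kmin] := penalty_minimizer.
have var h : (forall t : R, 0 < t -> t <= 1 -> cone (fun x y => k x y + t * h x y)) ->
  \sum_(x <- Y) \sum_(y <- Y) defect k x y * h x y <= \sum_(x <- Y) excess k x * h x x.
  move=> hc; rewrite -subr_ge0.
  apply: (first_order_ge0 (C := \sum_(x <- Y) \sum_(y <- Y) h x y ^+ 2
      + \sum_(x <- Y) h x x ^+ 2)).
    by apply: addr_ge0; apply: sumr_ge0 => x _;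
      [apply: sumr_ge0 => y _|]; exact: sqr_ge0.
  move=> t t0 t1; have := penalty_expansion k h t; have := kmin _ (hc t t0 t1); lra.
(* The direction -k is admissible as well, since (1 - t) k stays in the cone; u_+ u = u_+^2 then
   evaluates both sides. *)
have balance : \sum_(x <- Y) excess k x + \sum_(x <- Y) excess k x ^+ 2 <=
   (1 - e) * (\sum_(x <- Y) \sum_(y <- Y) defect k x y)
   - \sum_(x <- Y) \sum_(y <- Y) defect k x y ^+ 2.
  have := var (fun x y => - k x y).
  have -> : \sum_(x <- Y) \sum_(y <- Y) defect k x y * - k x y =
     - ((1 - e) * (\sum_(x <- Y) \sum_(y <- Y) defect k x y)
     - \sum_(x <- Y) \sum_(y <- Y) defect k x y ^+ 2).
    rewrite big_distrr -sumrN -big_split -sumrN /=; apply: eq_bigr => x _.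
    rewrite big_distrr -sumrN -big_split -sumrN /=; apply: eq_bigr => y _.
    rewrite /defect; case: ifP => _; last by rewrite expr0n /=; ring.
    by rewrite -pospart_mul; ring.
  have -> : \sum_(x <- Y) excess k x * - k x x =
     - (\sum_(x <- Y) excess k x + \sum_(x <- Y) excess k x ^+ 2).
    rewrite -big_split -sumrN /=; apply: eq_bigr => x _.
    by rewrite /excess -pospart_mul; ring.
  rewrite lerN2; apply=> t t0 t1.
  have -> : (fun x y => k x y + t * - k x y) = (fun x y => (1 - t) * k x y).
    by apply/funext => x; apply/funext => y; ring.
  case: ck => pk Sk; split; first by apply: psdZ => //; rewrite subr_ge0.
  by move=> x y /Sk ->; rewrite mulr0.
have mu0 : 0 <= \sum_(x <- Y) excess k x by apply: sumr_ge0 => x _; exact: pospart_ge0.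
have sq0 : 0 <= \sum_(x <- Y) excess k x ^+ 2 by apply: sumr_ge0 => x _; exact: sqr_ge0.
have sq1 : 0 <= \sum_(x <- Y) \sum_(y <- Y) defect k x y ^+ 2.
  by apply: sumr_ge0 => x _; apply: sumr_ge0 => y _; exact: sqr_ge0.
exists (defect k), (excess k); split.
- move=> x y; rewrite /defect /near_pair dsym andbCA; case: ck => -[ks _] _.
  by rewrite (ks x y).
- move=> x y; split; first exact: defect_ge0.
  by rewrite /defect; case: ifP => // _; rewrite eqxx.
- by move=> x; exact: pospart_ge0.
- move=> h [ph Sh]; apply: var => t t0 t1; case: ck => pk Sk; split.
    by apply: psdD => //; apply: psdZ => //; exact: ltW.
  by move=> x y hxy; rewrite Sk // Sh // mulr0 addr0.
split; first lra.
have w0 : 0 <= \sum_(x <- Y) \sum_(y <- Y) defect k x y.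
  by apply: sumr_ge0 => x _; apply: sumr_ge0 => y _; exact: defect_ge0.
(* If the total weight were 0, all defects would vanish, [balance] would make all excesses vanish,
   and the cut minimiser would be a good kernel. *)
rewrite lt_neqAle w0 andbT eq_sym; apply/negP => /eqP wE; apply: bad.
have dE x y : x \in Y -> y \in Y -> defect k x y = 0.
  move=> xY yY; have : defect k x y <= 0; last first.
    by move=> h; apply/eqP; rewrite eq_le h defect_ge0.
  rewrite -wE; apply: le_trans (_ : \sum_(y <- Y) defect k x y <= _).
    by rewrite (big_rem y) //= lerDl sumr_ge0 // => z _; exact: defect_ge0.
  rewrite [leRHS](big_rem x) //= lerDl sumr_ge0 // => z _.
  by apply: sumr_ge0 => z' _; exact: defect_ge0.
have xE x : x \in Y -> excess k x = 0.
  move=> xY; have : excess k x <= 0; last first.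
    by move=> h; apply/eqP; rewrite eq_le h pospart_ge0.
  have h : excess k x <= \sum_(x <- Y) excess k x.
    by rewrite (big_rem x) //= lerDl sumr_ge0 // => z _; exact: pospart_ge0.
  by apply: (le_trans h); move: balance; rewrite wE; lra.
have [pc Sc] := cut_kernel_cone ck.
exists (cut_kernel k); split=> //.
  move=> x; have [xY|xY] := boolP (x \in Y); last first.
    by rewrite /cut_kernel (negbTE xY) !mul0r.
  rewrite cut_kernelE //; have := pospart_ge (k x x - 1).
  by rewrite -/(excess k x) xE //; lra.
move=> x y xY yY hxy; have {}xY : x \in Y := xY; have {}yY : y \in Y := yY.
rewrite cut_kernelE //.
have := dE x y xY yY; rewrite /defect /near_pair xY yY hxy /= => h.
by have := pospart_ge (1 - e - k x y); rewrite h; lra.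
Qed.

End Duality.

Section LocalOperator.
Variable R : realType.
Variable X : choiceType.
Variable d : X -> X -> \bar R.
Hypothesis hd : is_emetric d.

(** Take a = s' and b = s. If one of s, s' is 0, its variable is unconstrained on the right, and a
    large value of it contradicts w > 0. *)
Lemma le_mul_of_forall (w s s' : R) : 0 <= s -> 0 <= s' ->
  (forall a b, 0 <= a -> 0 <= b -> 2 * w * a * b <= s ^+ 2 * a ^+ 2 + s' ^+ 2 * b ^+ 2) ->
  w <= s * s'.
Proof.
move=> s0 s'0 h; have [w0|w0] := leP w 0.
  by apply: le_trans w0 _; exact: mulr_ge0.
have big (u : R) : (0 <= (u ^+ 2 + 1) / (2 * w)) && (2 * w * ((u ^+ 2 + 1) / (2 * w)) == u ^+ 2 + 1).
  apply/andP; split; first by rewrite divr_ge0 ?addr_ge0 ?sqr_ge0 ?mulr_ge0 // ltW.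
  by rewrite mulrC divfK // mulf_neq0 ?lt0r_neq0.
have [sE|sn] := eqVneq s 0.
  have /andP[a0 /eqP aE] := big s'; have := h _ 1 a0 ler01.
  by rewrite aE sE expr0n mul0r add0r expr1n !mulr1; lra.
have [s'E|s'n] := eqVneq s' 0.
  have /andP[a0 /eqP aE] := big s; have := h 1 _ ler01 a0.
  by rewrite mulr1 aE s'E expr0n mul0r addr0 expr1n !mulr1; lra.
have ss : 0 < s * s' by rewrite mulr_gt0 // lt_neqAle eq_sym ?sn ?s'n.
have {h} : 2 * w * s' * s <= s ^+ 2 * s' ^+ 2 + s' ^+ 2 * s ^+ 2 := h s' s s'0 s0.
have -> : 2 * w * s' * s = (w * (s * s')) * 2 by ring.
have -> : s ^+ 2 * s' ^+ 2 + s' ^+ 2 * s ^+ 2 = (s * s' * (s * s')) * 2 by ring.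
by rewrite ler_pM2r // ler_pM2r.
Qed.

Lemma ge_sum2 (Y : seq X) (F : X -> R) x y : uniq Y -> (forall z, 0 <= F z) ->
  x \in Y -> y \in Y -> x != y -> F x + F y <= \sum_(z <- Y) F z.
Proof.
move=> uY F0 xY yY xy; rewrite (bigD1_seq x) //= lerD2l.
rewrite -big_filter (bigD1_seq y) ?filter_uniq //=; last first.
  by rewrite mem_filter eq_sym xy yY.
by rewrite lerDl sumr_ge0.
Qed.

Lemma ge_sum1 (Y : seq X) (F : X -> R) x : (forall z, 0 <= F z) ->
  x \in Y -> F x <= \sum_(z <- Y) F z.
Proof. by move=> F0 xY; rewrite (big_rem x) //= lerDl sumr_ge0. Qed.

(* The operator is T = D^-1/2 w D^-1/2 with D = diag mu, for the dual solution
   (w, mu); the test vector is the square root of mu. *)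
Lemma bad_operator (Y : seq X) (r e S : R) : uniq Y -> 0 <= r -> r <= S -> 0 < e ->
  ~ good_kernel d (mem Y) r e S ->
  exists (t : X -> X -> R) (xi : X -> R),
  [/\ forall x y, t x y = t y x,
      forall x y, 0 <= t x y <= 1 /\ (t x y != 0 -> near_pair d Y r x y),
      forall f : X -> R, (forall x y, f x != 0 -> f y != 0 -> (d x y <= S%:E)%E) ->
        \sum_(x <- Y) \sum_(y <- Y) t x y * (f x * f y) <= \sum_(x <- Y) f x ^+ 2,
      (1 + e) * (\sum_(x <- Y) xi x ^+ 2) <=
        \sum_(x <- Y) \sum_(y <- Y) t x y * (xi x * xi y) &
      0 < \sum_(x <- Y) xi x ^+ 2].
Proof.
move=> uY r0 rS e0 bad.
have [w [mu [wsym wnear mu0 dual [muw wpos]]]] := good_or_dual (dist_sym hd) bad.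
have w0 x y : 0 <= w x y by case: (wnear x y).
pose s x := Num.sqrt (mu x).
have s0 x : 0 <= s x by exact: sqrtr_ge0.
have ss x : s x ^+ 2 = mu x by exact: sqr_sqrtr.
have dual1 (f : X -> R) : (forall x y, f x != 0 -> f y != 0 -> (d x y <= S%:E)%E) ->
    \sum_(x <- Y) \sum_(y <- Y) w x y * (f x * f y) <= \sum_(x <- Y) mu x * (f x * f x).
  move=> fS; apply: (dual (fun x y => f x * f y)); split; first exact: psd_rank1.
  move=> x y; have [->|fx] := eqVneq (f x) 0; first by rewrite mul0r.
  have [->|fy] := eqVneq (f y) 0; first by rewrite mulr0.
  by rewrite ltNge fS.
(* Test vectors supported on {x, y} are local because r <= S; discarding the nonnegative diagonal
   terms leaves a quadratic inequality in the two values. *)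
have wle x y : w x y <= s x * s y.
  have [->|wxy] := eqVneq (w x y) 0; first exact: mulr_ge0.
  have /and3P[xY yY dxy] := (wnear x y).2 wxy.
  have dS : (d x y <= S%:E)%E by apply: le_trans dxy _; rewrite lee_fin.
  have dxx z : (d z z <= S%:E)%E by rewrite (dist_refl hd) lee_fin (le_trans r0).
  have [xE|xny] := eqVneq x y.
    subst y; have := dual1 (fun z => (z == x)%:R).
    have -> : \sum_(z <- Y) mu z * ((z == x)%:R * (z == x)%:R) = s x * s x.
      rewrite (bigD1_seq x) //= eqxx !mulr1 big1 ?addr0 -?expr2 ?ss // => z /negbTE ->.
      by rewrite mulr0 mulr0.
    move=> h; apply: le_trans (h _); last first.
      by move=> z z'; rewrite !pnatr_eq0 !eqb0 !negbK => /eqP -> /eqP ->.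
    have nn z z' : 0 <= w z z' * ((z == x)%:R * (z' == x)%:R).
      by rewrite !mulr_ge0 ?ler0n.
    apply: le_trans (ge_sum1 (F := fun z => \sum_(y <- Y) w z y * ((z == x)%:R * (y == x)%:R)) (x := x) _ xY).
      apply: le_trans (ge_sum1 (F := fun y => w x y * ((x == x)%:R * (y == x)%:R)) (x := x) _ xY).
        by rewrite eqxx !mulr1.
      by move=> z; exact: nn.
    by move=> z; apply: sumr_ge0 => z' _; exact: nn.
  apply: le_mul_of_forall => // a b a0 b0.
  pose f z := if z == x then a else if z == y then b else 0.
  have fx : f x = a by rewrite /f eqxx.
  have fy : f y = b by rewrite /f eq_sym (negbTE xny) eqxx.
  have f0 z : 0 <= f z by rewrite /f; case: ifP => // _; case: ifP.
  have fsupp z : f z != 0 -> z = x \/ z = y.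
    by rewrite /f; case: (eqVneq z x) => [->|_]; [left|
      case: (eqVneq z y) => [->|_]; [right|rewrite eqxx]].
  have := dual1 f.
  have -> : \sum_(z <- Y) mu z * (f z * f z) = s x ^+ 2 * a ^+ 2 + s y ^+ 2 * b ^+ 2.
    rewrite (bigD1_seq x) //= -big_filter (bigD1_seq y) ?filter_uniq //=; last first.
      by rewrite mem_filter eq_sym xny yY.
    rewrite big_filter_cond big1 => [|z /andP[zx zy]].
      by rewrite addr0 fx fy !ss !expr2.
    by rewrite /f (negbTE zx) (negbTE zy) !mulr0.
  move=> h; apply: le_trans (h _); last first.
    by move=> z z' /fsupp[]-> /fsupp[]-> //; rewrite (dist_sym hd).
  have nn z z' : 0 <= w z z' * (f z * f z') by rewrite !mulr_ge0.
  have := ge_sum2 (F := fun z => \sum_(y <- Y) w z y * (f z * f y)) uY _ xY yY xny.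
  move=> /(_ (fun z => sumr_ge0 _ (fun z' _ => nn z z'))); apply: le_trans.
  have h1 := ge_sum1 (F := fun z => w x z * (f x * f z)) (nn x) yY.
  have h2 := ge_sum1 (F := fun z => w y z * (f y * f z)) (nn y) xY.
  apply: le_trans (lerD h1 h2); rewrite fx fy (wsym y x).
  by rewrite le_eqVlt; apply/orP; left; apply/eqP; ring.
(* Division by zero yields 0, and by [wle] the numerator vanishes there too, so w = s t s always. *)
pose t x y := w x y / (s x * s y).
exists t, s; split.
- by move=> x y; rewrite /t wsym [s x * _]mulrC.
- move=> x y; split.
    rewrite divr_ge0 ?mulr_ge0 //=; have [sE|sn] := eqVneq (s x * s y) 0.
      by rewrite /t sE invr0 mulr0 ler01.
    by rewrite ler_pdivrMr ?mul1r // lt_neqAle eq_sym sn mulr_ge0.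
  by move=> txy; apply: (wnear x y).2; apply: contraNneq txy; rewrite /t => ->; rewrite mul0r.
- move=> f fS; apply: le_trans (_ : \sum_(x <- Y) \sum_(y <- Y) w x y * (f x / s x * (f y / s y)) <= _).
    rewrite le_eqVlt; apply/orP; left; apply/eqP.
    apply: eq_bigr => x _; apply: eq_bigr => y _; rewrite /t invfM; ring.
  apply: le_trans (dual1 (fun x => f x / s x) _) _.
    move=> x y fx fy; apply: fS; [apply: contraNneq fx|apply: contraNneq fy];
    by move=> ->; rewrite mul0r.
  apply: ler_sum => x _; have [sE|sn] := eqVneq (s x) 0.
    by rewrite sE invr0 mulr0 mul0r mulr0 sqr_ge0.
  rewrite -ss; have -> : s x ^+ 2 * (f x / s x * (f x / s x)) = f x ^+ 2 by field.
  exact: lexx.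
- have -> : \sum_(x <- Y) \sum_(y <- Y) t x y * (s x * s y) =
            \sum_(x <- Y) \sum_(y <- Y) w x y.
    apply: eq_bigr => x _; apply: eq_bigr => y _; rewrite /t.
    have [sE|sn] := eqVneq (s x * s y) 0; last by rewrite divfK.
    by rewrite sE mulr0; apply/eqP; rewrite eq_sym eq_le w0 andbT -sE.
  under eq_bigr do rewrite ss.
  (* (1 + e) sum mu <= (1 + e)(1 - e) sum w <= sum w. *)
  have := mulr_ge0 (sqr_ge0 e) (ltW wpos); nra.
have muE : \sum_(x <- Y) s x ^+ 2 = \sum_(x <- Y) mu x by apply: eq_bigr.
rewrite muE lt_neqAle sumr_ge0 // andbT eq_sym; apply/negP => /eqP mu_0.
have s_0 x : x \in Y -> s x = 0.
  move=> xY; have := ge_sum1 mu0 xY; rewrite mu_0 => h.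
  by rewrite /s ler0_sqrtr.
move: wpos; apply/negP; rewrite -leNgt.
rewrite big_seq; apply: sumr_le0 => x xY; rewrite big_seq; apply: sumr_le0 => y yY.
by have := wle x y; rewrite s_0 // mul0r.
Qed.

End LocalOperator.

(** * Functional calculus on a finite block *)

Section AbsApproximation.
Variable R : realType.
Implicit Types u : R.

(* A polynomial in u, so that on operators of finite propagation it has finite
   propagation; it converges to |u| uniformly on [-1, 1]. *)
Fixpoint abs_approx (m : nat) u : R :=
  if m is m'.+1 then
    abs_approx m' u + (u ^+ 2 - abs_approx m' u ^+ 2) / 2
  else 0.

(** With a = |u| and q the current value, one step multiplies the error a - q by 1 - (a + q)/2,
    which lies between 0 and 1 - a/2. *)
Lemma abs_approx_bounds m u : `|u| <= 1 ->
  0 <= abs_approx m u <= `|u| /\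
  `|u| - abs_approx m u <= `|u| * (1 - `|u| / 2) ^+ m.
Proof.
move=> u1; have u0 := normr_ge0 u.
elim: m => [|m [/andP[q0 q1] IH]] /=; first by rewrite lexx u0 expr0; split=> //; lra.
rewrite -(real_normK (num_real u)); move: (`|u|) (abs_approx m u) u0 u1 q0 q1 IH => a q a0 a1 q0 q1.
have p0 : 0 <= (1 - a / 2) ^+ m by apply: exprn_ge0; lra.
rewrite [_ ^+ m.+1]exprS; move: ((1 - a / 2) ^+ m) p0 => p p0 IH; split; first by apply/andP; split; nra.
have h : (a - q) * (1 - a / 2) <= a * p * (1 - a / 2) by rewrite ler_wpM2r //; lra.
have : 0 <= q * (a - q) by rewrite mulr_ge0 ?subr_ge0.
lra.
Qed.

(** These are two of the nonnegative terms of the binomial expansion of (x + (1 - x))^(m+1) = 1. For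
    x = |u|/2 they give the error 2 / (m+1). *)
Lemma bernoulli_bound m (x : R) : 0 <= x -> x <= 1 ->
  m.+1%:R * (x * (1 - x) ^+ m) + (1 - x) ^+ m.+1 <= 1.
Proof.
move=> x0 x1; elim: m => [|m IH]; first by rewrite expr0 expr1; lra.
have y0 : 0 <= 1 - x by lra.
have p1 : (1 - x) ^+ m.+1 <= 1 by apply: exprn_ile1 => //; lra.
have p0 : 0 <= (1 - x) ^+ m.+1 by exact: exprn_ge0.
have := ler_wpM2l y0 IH.
rewrite -[m.+2%:R]natr1 ![(1 - x) ^+ m.+2]exprS.
rewrite {1 2}exprS in p1 p0 *.
move: (m.+1%:R : R) p0 p1; rewrite !exprS; move: ((1 - x) ^+ m) => p n p0 p1; nra.
Qed.

Lemma abs_approx_error m u : `|u| <= 1 -> `| `|u| - abs_approx m u | <= 2 / m.+1%:R.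
Proof.
move=> u1; have [/andP[q0 q1] h] := abs_approx_bounds m u1.
rewrite ger0_norm ?subr_ge0 // (le_trans h) // ler_pdivlMr //.
have u0 := normr_ge0 u.
have x0 : 0 <= `|u| / 2 by lra.
have x1 : `|u| / 2 <= 1 by lra.
have := bernoulli_bound m x0 x1.
have : 0 <= (1 - `|u| / 2) ^+ m.+1 by apply: exprn_ge0; lra.
by move: (_ ^+ m.+1) (_ ^+ m) (m.+1%:R) => p p' n; nra.
Qed.

End AbsApproximation.

Section Block.
Variable R : realType.
Variable X : choiceType.
Variable d : X -> X -> \bar R.
Hypothesis hd : is_emetric d.
Variables (Y : seq X) (r e : R) (N k : nat).
Hypotheses (uY : uniq Y) (r0 : 0 < r) (e0 : 0 < e) (hN : ball_card d r N).
Variable t : X -> X -> R.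
Hypothesis t_bound : forall x y, 0 <= t x y <= 1 /\ (t x y != 0 -> near_pair d Y r x y).
Hypothesis t_local : forall f : X -> R,
  (forall x y, f x != 0 -> f y != 0 -> (d x y <= (2 * (k%:R * r))%:E)%E) ->
  \sum_(x <- Y) \sum_(y <- Y) t x y * (f x * f y) <= \sum_(x <- Y) f x ^+ 2.

Variables (n : nat) (ev : 'I_n -> R) (q : 'I_n -> X -> R[i]).
Hypothesis q_orth : forall i j, \sum_(x <- Y) q i x * (q j x)^* = (i == j)%:R.
Hypothesis q_complete : forall x y, x \in Y -> y \in Y ->
  \sum_j q j x * (q j y)^* = (x == y)%:R.
Hypothesis q_t : forall x y, x \in Y -> y \in Y ->
  (t x y)%:C%C = \sum_j (ev j)%:C%C * (q j x * (q j y)^*).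
Hypothesis q_supp : forall j x, x \notin Y -> q j x = 0.

Let T : opmat R X := fun x y => (t x y)%:C%C.

Lemma calc_ev x y : calc q ev x y = T x y.
Proof.
have [xy|xy] := boolP ((x \notin Y) || (y \notin Y)).
  rewrite (calc_supp q_supp) // /T; have [->//|txy] := eqVneq (t x y) 0.
  by have /and3P[xY yY _] := (t_bound x y).2 txy; rewrite xY yY in xy.
by move: xy; rewrite negb_or !negbK => /andP[xY yY]; rewrite /T q_t.
Qed.

Lemma T_form_bound : form_bound T N%:R.
Proof.
rewrite -[N%:R]mul1r; apply: (bounded_geometry_form_bound (dist_sym hd) hN) => //.
  move=> x y; rewrite /T => txy; have : t x y != 0.
    by apply: contraNneq txy => ->.
  by move=> /(t_bound x y).2/and3P[].
move=> x y; rewrite sqnC; have [/andP[t0 t1] _] := t_bound x y.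
by rewrite ler_sqr ?nnegrE.
Qed.

Lemma sqs_q j : sqs Y (q j) = 1.
Proof.
apply: complexI; rewrite /sqs rmorph_sum rmorph1 /=.
have h := q_orth j j; rewrite eqxx in h.
by apply: etrans h; apply: eq_bigr => x _; rewrite sqn_Cr.
Qed.

Lemma ev_bound j : `|ev j| <= N%:R.
Proof.
have Tq : form_on T Y (q j) (q j) = (ev j)%:C%C.
  by rewrite (calc_eigenvalue q_orth); apply: eq_form_on => x y; rewrite calc_ev.
have := T_form_bound (q j) (q j) uY; rewrite Tq sqs_q /=.
have := form_boundN T_form_bound (q j) (q j) uY; rewrite sqs_q.
have -> : form_on (fun x y => - T x y) Y (q j) (q j) = - form_on T Y (q j) (q j).
  rewrite /form_on -sumrN; apply: eq_bigr => x _; rewrite -sumrN.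
  by apply: eq_bigr => y _; rewrite mulrN mulNr.
by rewrite Tq /= ler_norml => *; apply/andP; split; lra.
Qed.

Lemma calcJ a x y : (calc q a x y)^* = calc q a y x.
Proof.
rewrite /calc rmorph_sum; apply: eq_bigr => j _.
rewrite !rmorphM /= conjCK [in RHS]mulrC [in LHS]mulrC [(q j x)^* * _]mulrC.
by congr (_ * _); exact: conjc_real.
Qed.

(** The numbers [sqn (q j y)] are the masses of the spectral measure of delta_y, so this entry is an
    integral against it. *)
Lemma calc_diag a y : calc q a y y = (\sum_j a j * sqn (q j y))%:C%C.
Proof.
rewrite rmorph_sum; apply: eq_bigr => j _.
by rewrite rmorphM /= sqn_Cr.
Qed.

(** By self-adjointness, the squared norm of a column of a(T) is a diagonal entry of a(T)^2. *)
Lemma calc_column a y : \sum_(z <- Y) sqn (calc q a z y) = \sum_j a j ^+ 2 * sqn (q j y).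
Proof.
apply: complexI; rewrite -calc_diag.
have -> : calc q (fun j => a j ^+ 2) y y = calc q (fun j => a j * a j) y y by [].
rewrite -(calcM q_orth) rmorph_sum; apply: eq_bigr => z _ /=.
by rewrite sqn_Cr calcJ mulrC.
Qed.

Lemma calc_entry a x y : sqn (calc q a x y) <= \sum_j a j ^+ 2 * sqn (q j y).
Proof.
have [xY|xY] := boolP (x \in Y).
  rewrite -calc_column; apply: (ge_sum1 (F := fun z => sqn (calc q a z y))) => // z.
  exact: sqn_ge0.
rewrite (calc_supp q_supp) ?xY // sqn0 sumr_ge0 // => j _.
by rewrite mulr_ge0 ?sqr_ge0 ?sqn_ge0.
Qed.

Lemma calc_prop_mono a (s s' : R) : s <= s' -> prop_le d (calc q a) s -> prop_le d (calc q a) s'.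
Proof. by move=> ss h x y /h; move/le_trans; apply; rewrite lee_fin. Qed.

Lemma calc_propM a b (s s' : R) : prop_le d (calc q a) s -> prop_le d (calc q b) s' ->
  prop_le d (calc q (fun j => a j * b j)) (s + s').
Proof.
move=> ha hb x y; rewrite -(calcM q_orth); apply: contraNT; rewrite -ltNge => hxy.
rewrite big1 // => z _; have [->|az] := eqVneq (calc q a x z) 0; first exact: mul0r.
have [->|bz] := eqVneq (calc q b z y) 0; first exact: mulr0.
have : (d x y <= (s + s')%:E)%E.
  have [_ _ _ tri] := hd; apply: le_trans (tri x z y) _.
  by rewrite EFinD leeD ?ha ?hb.
by rewrite leNgt hxy.
Qed.

Lemma calc_linear (a b : 'I_n -> R) (u v : R) x y :
  calc q (fun j => u * a j + v * b j) x y = u%:C%C * calc q a x y + v%:C%C * calc q b x y.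
Proof.
rewrite /calc !big_distrr -big_split /=; apply: eq_bigr => j _.
by rewrite rmorphD !rmorphM /= mulrDl !mulrA.
Qed.

Lemma calc_propL a b (u v s : R) : prop_le d (calc q a) s -> prop_le d (calc q b) s ->
  prop_le d (calc q (fun j => u * a j + v * b j)) s.
Proof.
move=> ha hb x y; rewrite calc_linear; apply: contraNT => hxy.
have -> : calc q a x y = 0 by apply: contraNeq hxy => /ha.
have -> : calc q b x y = 0 by apply: contraNeq hxy => /hb.
by rewrite !mulr0 addr0.
Qed.

Lemma calc_prop1 : prop_le d (calc q (fun=> 1)) 0.
Proof.
move=> x y; have [xy|xy] := boolP ((x \notin Y) || (y \notin Y)).
  by rewrite (calc_supp q_supp) // eqxx.
move: xy; rewrite negb_or !negbK => /andP[xY yY].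
have -> : calc q (fun=> 1) x y = (x == y)%:R.
  by rewrite -q_complete //; apply: eq_bigr => j _; rewrite mul1r.
by case: (eqVneq x y) => [->|_]; rewrite ?eqxx // (dist_refl hd).
Qed.

Lemma calc_prop_affine (u v : R) : prop_le d (calc q (fun j => u * ev j + v)) r.
Proof.
have -> : (fun j => u * ev j + v) = (fun j => u * ev j + v * 1).
  by apply/funext => j; rewrite mulr1.
apply: (calc_propL (b := fun=> 1)); last exact: calc_prop_mono (ltW r0) calc_prop1.
move=> x y; rewrite calc_ev /T => txy; have : t x y != 0.
  by apply: contraNneq txy => ->.
by move=> /(t_bound x y).2/and3P[].
Qed.

Lemma calc_prop_pow (v : R) m : prop_le d (calc q (fun j => (ev j + v) ^+ m)) (m%:R * r).
Proof.
elim: m => [|m IH]; first by rewrite mul0r; exact: calc_prop1.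
have -> : (fun j => (ev j + v) ^+ m.+1) = (fun j => (1 * ev j + v) * (ev j + v) ^+ m).
  by apply/funext => j; rewrite mul1r exprS.
rewrite -natr1 mulrDl mul1r addrC.
by apply: (calc_propM (a := fun j => 1 * ev j + v)) => //; exact: calc_prop_affine.
Qed.

(** Each step squares the previous polynomial, so the degree at most doubles. *)
Lemma calc_prop_abs_approx (u v : R) m :
  prop_le d (calc q (fun j => abs_approx m (u * ev j + v))) (2 ^+ m * r).
Proof.
have pA := @calc_prop_affine u v.
elim: m => [|m IH] /=.
  by move=> x y; rewrite /calc big1 ?eqxx // => j _; rewrite mul0r.
have r_le (i : nat) : r <= 2 ^+ i * r by rewrite ler_peMl ?(ltW r0) // exprn_ege1 // ler1n.
have h2 : 2 ^+ m.+1 * r = 2 ^+ m * r + 2 ^+ m * r by rewrite exprS; ring.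
have -> : (fun j => abs_approx m (u * ev j + v)
     + ((u * ev j + v) ^+ 2 - abs_approx m (u * ev j + v) ^+ 2) / 2) =
  (fun j => 1 * abs_approx m (u * ev j + v) + 1 * (2^-1 * ((u * ev j + v) * (u * ev j + v)) +
    (- 2^-1) * (abs_approx m (u * ev j + v) * abs_approx m (u * ev j + v)))).
  by apply/funext => j; field.
apply: calc_propL.
  by apply: calc_prop_mono IH; rewrite h2 lerDl mulr_ge0 ?exprn_ge0 // ltW.
apply: calc_propL; rewrite h2; last exact: calc_propM.
by apply: calc_prop_mono (calc_propM pA pA); rewrite lerD.
Qed.

(* [t_local] applied to the real and imaginary parts of (T + N)^k delta_y. *)
Lemma local_moment y : y \in Y ->
  \sum_j (ev j - 1) * ((ev j + N%:R) ^+ k) ^+ 2 * sqn (q j y) <= 0.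
Proof.
move=> yY; pose a j := (ev j + N%:R) ^+ k.
pose f z := calc q a z y.
have fsupp x : f x != 0 -> (d x y <= (k%:R * r)%:E)%E by exact: calc_prop_pow.
have near (g : X -> R) : (forall z, g z != 0 -> f z != 0) -> forall x z, g x != 0 ->
    g z != 0 -> (d x z <= (2 * (k%:R * r))%:E)%E.
  move=> gf x z /gf/fsupp hx /gf/fsupp hz; have [_ _ _ tri] := hd.
  apply: le_trans (tri x y z) _; rewrite mulr2n mulrDl !mul1r EFinD.
  by rewrite leeD // (dist_sym hd).
have Ref z : complex.Re (f z) != 0 -> f z != 0 by apply: contraNneq => ->.
have Imf z : complex.Im (f z) != 0 -> f z != 0 by apply: contraNneq => ->.
have h1 := t_local (near _ Ref); have h2 := t_local (near _ Imf).
(* For f = (T + N)^k delta_y, the form of T at f is the (y, y) entry of T (T + N)^(2k). *)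
have E : form_on T Y f f = calc q (fun j => ev j * a j ^+ 2) y y.
  transitivity (\sum_(x <- Y) calc q a y x * calc q (fun j => ev j * a j) x y).
    apply: eq_bigr => x _; rewrite -(calcM q_orth) big_distrr /=.
    by apply: eq_bigr => z _; rewrite calcJ calc_ev mulrA.
  rewrite (calcM q_orth); congr (calc q _ y y); apply/funext => j; ring.
have Er : complex.Re (form_on T Y f f) =
   \sum_(x <- Y) \sum_(z <- Y) t x z * (complex.Re (f x) * complex.Re (f z)) +
   \sum_(x <- Y) \sum_(z <- Y) t x z * (complex.Im (f x) * complex.Im (f z)).
  rewrite /form_on Re_sum -big_split /=; apply: eq_bigr => x _.
  rewrite Re_sum -big_split /=; apply: eq_bigr => z _; rewrite /T.
  by case: (f x) => u v; case: (f z) => u' v' /=; ring.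
have : complex.Re (form_on T Y f f) <= \sum_(z <- Y) sqn (f z).
  by rewrite Er big_split /=; apply: lerD.
rewrite E calc_diag calc_column /= -subr_le0 -sumrB; apply: le_trans.
by rewrite le_eqVlt; apply/orP; left; apply/eqP; apply: eq_bigr => j _; rewrite /a; ring.
Qed.

Let M : R := 1 + N%:R.
Let c' : R := 1 + e / 2.
Let M' : R := c' + N%:R.

(** Geometric decay in k: M bounds t + N for spectral values t <= 1, while t + N >= M' > M for t >=
    1 + e/2. *)
Definition ghost_rate : R := M' ^+ 2 * (M / (e / 2)) * ((M / M') ^+ 2) ^+ k.

Lemma top_mass y : y \in Y ->
  \sum_j pospart (ev j - c') ^+ 2 * sqn (q j y) <= ghost_rate.
Proof.
move=> yY.
have M0 : 0 < M by rewrite ltr_pwDl.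
have e2 : 0 < e / 2 by rewrite divr_gt0.
have M'E : M' = M + e / 2 by rewrite /M' /M /c'; ring.
have M'0 : 0 < M' by rewrite M'E addr_gt0.
have massE : \sum_j sqn (q j y) = 1.
  apply: complexI; rewrite rmorph_sum rmorph1 /=.
  have h := q_complete yY yY; rewrite eqxx in h.
  by apply: etrans h; apply: eq_bigr => j _; rewrite sqn_Cr.
pose K := M' ^+ 2 / (e / 2 * (M' ^+ k) ^+ 2).
have K0 : 0 <= K by apply: divr_ge0; rewrite ?sqr_ge0 //; apply: mulr_ge0; rewrite ?sqr_ge0 // ltW.
have rateE : ghost_rate = K * (M * (M ^+ k) ^+ 2).
  rewrite /ghost_rate /K -exprM mulnC exprM expr_div_n; field.
  by rewrite expf_neq0 lt0r_neq0.
(* To be integrated against the spectral measure of delta_y, of mass 1: [local_moment] disposes of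
   the first term. For ev j < 1 the second term compensates the negative first one; above c' the
   first term alone suffices by the choice of K. *)
have pt j : pospart (ev j - c') ^+ 2 <=
    K * ((ev j - 1) * ((ev j + N%:R) ^+ k) ^+ 2 + M * (M ^+ k) ^+ 2).
  have := ev_bound j; rewrite ler_norml => /andP[l1 l2].
  have s0 : 0 <= ev j + N%:R by lra.
  have p0 : 0 <= (ev j + N%:R) ^+ k by exact: exprn_ge0.
  have [h|h] := leP (ev j - c') 0.
    rewrite /pospart ler0_norm // addrN mul0r expr0n mulr_ge0 //.
    have [h1|h1] := leP 1 (ev j).
      by apply: addr_ge0; apply: mulr_ge0; rewrite ?sqr_ge0 ?subr_ge0 // ltW.
    have hp : ((ev j + N%:R) ^+ k) ^+ 2 <= (M ^+ k) ^+ 2.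
      have sM : ev j + N%:R <= M by rewrite /M lerD2r ltW.
      by rewrite ler_sqr ?nnegrE ?exprn_ge0 ?(ltW M0) // lerXn2r ?nnegrE // ltW.
    have := ler_wpM2l (ltW M0) hp.
    have : 0 <= (ev j + N%:R) * ((ev j + N%:R) ^+ k) ^+ 2 by rewrite mulr_ge0 ?sqr_ge0.
    rewrite {1 3}/M; move: (_ ^+ 2) => A; move: (_ ^+ 2) => B; nra.
  rewrite /pospart ger0_norm ?(ltW h) //.
  apply: le_trans (_ : M' ^+ 2 <= _).
    by rewrite ler_sqr ?nnegrE ?(ltW M'0) //; move: h; rewrite /M' /c'; lra.
  have D0 : 0 < e / 2 * (M' ^+ k) ^+ 2 by apply: mulr_gt0 => //; rewrite !exprn_gt0.
  rewrite /K mulrAC -mulrA ler_peMr ?sqr_ge0 // ler_pdivlMr //.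
  rewrite mul1r; apply: ler_wpDr; first by rewrite mulr_ge0 ?sqr_ge0 // ltW.
  have hs : M' <= ev j + N%:R by rewrite /M' lerD2r; lra.
  apply: ler_pM; rewrite ?sqr_ge0 ?(ltW e2) //; first by move: h; rewrite /c'; lra.
  by rewrite ler_sqr ?nnegrE ?exprn_ge0 ?(ltW M'0) // lerXn2r ?nnegrE // ltW.
apply: le_trans (_ : \sum_j K * ((ev j - 1) * ((ev j + N%:R) ^+ k) ^+ 2 + M * (M ^+ k) ^+ 2)
   * sqn (q j y) <= _).
  by apply: ler_sum => j _; rewrite ler_wpM2r ?sqn_ge0.
under eq_bigr do rewrite -mulrA mulrDl.
rewrite -big_distrr big_split /= -big_distrr /= massE mulr1 rateE ler_wpM2l //.
by rewrite gerDr local_moment.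
Qed.

Lemma ev_shift_bound j : `|ev j - c'| <= M'.
Proof.
have := ev_bound j; have := e0; rewrite !ler_norml /M' /c' => e1 /andP[h1 h2].
by apply/andP; split; lra.
Qed.

Let Mpos : 0 < M'.
Proof. by rewrite /M' /c' ltr_pwDl // addr_gt0 // divr_gt0. Qed.

(** The positive part (u + |u|)/2 with |u| replaced by a polynomial; dividing by M' brings u = ev j
    - c' into [-1, 1]. *)
Definition top_approx m j : R :=
  (ev j - c' + M' * abs_approx m ((ev j - c') / M')) / 2.

Lemma top_approx_error m j : `|pospart (ev j - c') - top_approx m j| <= M' / m.+1%:R.
Proof.
set u := ev j - c'; pose v := u / M'.
have uE : u = M' * v by rewrite /v mulrC divfK // lt0r_neq0.
have v1 : `|v| <= 1.
  by rewrite /v normrM normfV (gtr0_norm Mpos) ler_pdivrMr // mul1r ev_shift_bound.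
have -> : pospart u - top_approx m j = M' * ((`|v| - abs_approx m v) / 2).
  by rewrite /pospart /top_approx -/u -/v {2}uE normrM (gtr0_norm Mpos); field.
have half : 0 <= 2^-1 :> R by rewrite invr_ge0.
rewrite normrM (gtr0_norm Mpos) ler_pM2l // normrM (ger0_norm half).
rewrite ler_pdivrMr //; apply: le_trans (abs_approx_error m v1) _.
by rewrite mulrC.
Qed.

Lemma top_approx_prop m : prop_le d (calc q (top_approx m)) (2 ^+ m * r).
Proof.
have -> : top_approx m = (fun j => 2^-1 * (1 * ev j + - c') +
    (M' / 2) * abs_approx m (M'^-1 * ev j + - c' / M')).
  apply/funext => j; rewrite /top_approx.
  have -> : M'^-1 * ev j + - c' / M' = (ev j - c') / M' by ring.
  by field.
apply: calc_propL; last exact: calc_prop_abs_approx.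
apply: calc_prop_mono (@calc_prop_affine 1 (- c')).
by rewrite ler_peMl ?(ltW r0) // exprn_ege1 // ler1n.
Qed.

Lemma top_form (xi : X -> R) :
  (1 + e) * (\sum_(x <- Y) xi x ^+ 2) <=
    \sum_(x <- Y) \sum_(y <- Y) t x y * (xi x * xi y) ->
  e / 2 * sqs Y (fun x => (xi x)%:C%C) <=
  complex.Re (form_on (calc q (fun j => pospart (ev j - c'))) Y
     (fun x => (xi x)%:C%C) (fun x => (xi x)%:C%C)).
Proof.
set f := fun x => (xi x)%:C%C => h.
have sE : sqs Y f = \sum_(x <- Y) xi x ^+ 2 by apply: eq_bigr => x _; rewrite sqnC.
have formE a : complex.Re (form_on (calc q a) Y f f) = \sum_j a j * sqn (coef Y q f j).
  rewrite form_calc Re_sum; apply: eq_bigr => j _.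
  by rewrite -sqn_Cr -rmorphM.
have TE : \sum_(x <- Y) \sum_(y <- Y) t x y * (xi x * xi y)
     = \sum_j ev j * sqn (coef Y q f j).
  rewrite -formE (eq_form_on Y f f calc_ev) Re_sum; apply: eq_bigr => x _.
  rewrite Re_sum; apply: eq_bigr => y _; rewrite /T /f /=; ring.
rewrite formE; apply: le_trans (_ : \sum_j (ev j - c') * sqn (coef Y q f j) <= _).
  under eq_bigr do rewrite mulrBl.
  rewrite sumrB -big_distrr /= (coef_parseval uY q_complete) -TE.
  by move: h; rewrite -sE /c'; lra.
by apply: ler_sum => j _; rewrite ler_wpM2r ?sqn_ge0 ?pospart_ge.
Qed.

End Block.

(** * Block sums *)

Section BlockSum.
Variable R : realType.
Variable X : choiceType.
Implicit Types (T : opmat R X) (F : seq X) (f g : X -> R[i]).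
Variable Y : nat -> seq X.
Hypothesis uY : forall k, uniq (Y k).
Hypothesis disjY : forall x k l, x \in Y k -> x \in Y l -> k = l.

Definition off_zero (G : nat -> opmat R X) := forall k x y,
  (x \notin Y k) || (y \notin Y k) -> G k x y = 0.

(** Outside all blocks the default 0 is harmless: under [off_zero], G 0 vanishes off its own
    block. *)
Definition block_index (x : X) : nat :=
  if pselect (exists k, x \in Y k) is left h then ex_minn h else 0.

Lemma block_indexE x k : x \in Y k -> block_index x = k.
Proof.
move=> xk; rewrite /block_index; case: pselect => [h|[]]; last by exists k.
by case: ex_minnP => l xl _; exact: disjY xl xk.
Qed.

Definition block_sum (G : nat -> opmat R X) : opmat R X :=
  fun x y => G (block_index x) x y.

Lemma block_sumE G x y (K : nat) : off_zero G -> (block_index x < K)%N ->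
  block_sum G x y = \sum_(k < K) G k x y.
Proof.
move=> G0 xK; rewrite (bigD1 (Ordinal xK)) //= big1 ?addr0 // => k kx.
apply: G0; apply/orP; left; apply/negP => xk; move/negP: kx; apply.
by apply/eqP/val_inj; rewrite /= (block_indexE xk).
Qed.

(** A finite F meets only finitely many blocks, so K depends on F. *)
Lemma block_sum_form G F f g : off_zero G ->
  exists K : nat, form_on (block_sum G) F f g = \sum_(k < K) form_on (G k) F f g.
Proof.
move=> G0; exists (\max_(x <- F) block_index x).+1.
rewrite /form_on [RHS]exchange_big /= big_seq [RHS]big_seq; apply: eq_bigr => x xF.
rewrite [RHS]exchange_big /=; apply: eq_bigr => y _.
rewrite (block_sumE y G0 (K := (\max_(x <- F) block_index x).+1)); last first.
  by rewrite ltnS (big_rem x) //= leq_maxl.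
by rewrite big_distrr big_distrl.
Qed.

Lemma block_sqs F f (K : nat) : \sum_(k < K) sqs F (restr (Y k) f) <= sqs F f.
Proof.
rewrite exchange_big /=; apply: ler_sum => x _.
have [[k xk]|nx] := pselect (exists k : 'I_K, x \in Y k); last first.
  rewrite big1 ?sqn_ge0 // => k _; rewrite /restr ifN ?sqn0 //.
  by apply/negP => xk; apply: nx; exists k.
rewrite (bigD1 k) //= /restr xk big1 ?addr0 // => l lk; rewrite ifN ?sqn0 //.
by apply: contra lk => xl; apply/eqP/val_inj; exact: disjY xl xk.
Qed.

(** Orthogonality of the blocks: each block sees only the parts of f and g on it, and their squared
    norms add up to at most those of f and g. *)
Lemma block_sum_bound G c : 0 <= c -> off_zero G ->
  (forall k, form_bound (G k) c) -> form_bound (block_sum G) c.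
Proof.
move=> c0 G0 hG F f g uF; have [K ->] := block_sum_form F f g G0.
apply: le_trans (_ : \sum_(k < K) c * (sqs F (restr (Y k) f) + sqs F (restr (Y k) g)) <= _).
  rewrite Re_sum big_distrr; apply: ler_sum => k _ /=.
  have -> : form_on (G k) F f g = form_on (G k) F (restr (Y k) f) (restr (Y k) g).
    apply: eq_bigr => x _; apply: eq_bigr => y _; rewrite /restr.
    have [xk|xk] := boolP (x \in Y k); last by rewrite G0 ?xk // !mulr0 !mul0r.
    have [yk|yk] := boolP (y \in Y k); first by [].
    by rewrite G0 ?yk ?orbT // !mulr0 mul0r.
  exact: hG.
by rewrite -big_distrr big_split /= ler_wpM2l // lerD // block_sqs.
Qed.

Lemma block_sum_prop (d : X -> X -> \bar R) G s :
  (forall k, prop_le d (G k) s) -> prop_le d (block_sum G) s.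
Proof. by move=> h x y; exact: h. Qed.

Definition first_blocks (K : nat) := flatten [seq Y k | k <- iota 0 K].

Lemma mem_first_blocks K x : (x \in first_blocks K) <-> exists2 k, (k < K)%N & x \in Y k.
Proof.
split=> [/flatten_mapP[k]|[k kK xk]]; first by rewrite mem_iota => /andP[_ kK] xk; exists k.
by apply/flatten_mapP; exists k => //; rewrite mem_iota.
Qed.

Lemma first_blocks_uniq K : uniq (first_blocks K).
Proof.
elim: K => [//|K IH]; rewrite /first_blocks -addn1 iotaD map_cat flatten_cat /= cats0.
rewrite cat_uniq IH uY andbT /=; apply/hasPn => x xK; apply/negP => /mem_first_blocks[k kK xk].
by rewrite (disjY xk xK) ltnn in kK.
Qed.

Lemma sqs_first_blocks K f : sqs (first_blocks K) f = \sum_(k < K) sqs (Y k) f.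
Proof.
rewrite -(big_mkord xpredT (fun k => sqs (Y k) f)) /index_iota subn0.
by rewrite /sqs /first_blocks big_flatten big_map. Qed.

(** As a norm bound for the identity this is the Cauchy-Schwarz inequality. *)
Lemma identity_bounded : bounded_by (fun x y : X => (x == y)%:R : R[i]) 1.
Proof.
apply: form_bound_bounded => // F f g uF; rewrite /form_on Re_sum mul1r -big_split /=.
rewrite big_distrr /= !big_seq; apply: ler_sum => x xF.
rewrite (bigD1_seq x) //= big1 ?addr0 => [|y]; last first.
  by rewrite eq_sym => /negbTE ->; rewrite mulr0 mul0r.
rewrite eqxx mulr1 -[leRHS]mul1r; apply: Re_le; rewrite ?sqn_ge0 //.
by rewrite sqnM sqnJ expr1n mul1r mulrC.
Qed.

Lemma cauchy_schwarz F f g : uniq F ->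
  sqn (\sum_(x <- F) (g x)^* * f x) <= sqs F g * sqs F f.
Proof.
move=> uF; have := identity_bounded f g uF.
rewrite !sqnorm_onE sqnE -!rmorphM /= lecR expr1n mul1r.
congr (sqn _ <= _); rewrite /form_on !big_seq; apply: eq_bigr => x xF.
rewrite (bigD1_seq x) //= eqxx mulr1 big1 ?addr0 // => y.
by rewrite eq_sym => /negbTE ->; rewrite mulr0 mul0r.
Qed.

(** A finite rank K within e/2 would have form at least (e/2) |xi_k|^2 at every xi_k. By
    Cauchy-Schwarz the vectors defining K then have total squared norm at least e on each block,
    contradicting square summability. *)
Lemma block_sum_not_compact G (xi : nat -> X -> R[i]) (e : R) : 0 < e ->
  (forall k, e * sqs (Y k) (xi k) <= complex.Re (form_on (G k) (Y k) (xi k) (xi k))) ->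
  (forall k, 0 < sqs (Y k) (xi k)) -> ~ compact_op (block_sum G).
Proof.
move=> e0 hxi xi0 [_ cG].
have e2 : 0 < e / 2 by rewrite divr_gt0.
have [K [[n [u [v [hu [hv KE]]]]] hK]] := cG _ e2.
have hK' := bounded_form_bound_ge0 (ltW e2) hK.
have key k : e <= \sum_(l < n) (sqs (Y k) (u l) + sqs (Y k) (v l)).
  have := hK' (Y k) (xi k) (xi k) (uY k).
  have -> : form_on (mat_sub (block_sum G) K) (Y k) (xi k) (xi k)
     = form_on (G k) (Y k) (xi k) (xi k) - form_on K (Y k) (xi k) (xi k).
    rewrite /form_on -sumrB !big_seq; apply: eq_bigr => x xk.
    rewrite -sumrB; apply: eq_bigr => y _.
    by rewrite /mat_sub /block_sum (block_indexE xk) mulrBr mulrBl.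
  have FE : form_on K (Y k) (xi k) (xi k) = \sum_(l < n)
      (\sum_(x <- Y k) (xi k x)^* * u l x) * (\sum_(y <- Y k) (v l y)^* * xi k y).
    under [RHS]eq_bigr do rewrite big_distrlr /=.
    rewrite exchange_big /=; apply: eq_bigr => x _.
    rewrite exchange_big /=; apply: eq_bigr => y _.
    rewrite KE big_distrr big_distrl /=; apply: eq_bigr => l _; ring.
  have FR : 2 * complex.Re (form_on K (Y k) (xi k) (xi k)) <=
      sqs (Y k) (xi k) * \sum_(l < n) (sqs (Y k) (u l) + sqs (Y k) (v l)).
    rewrite FE Re_sum !big_distrr /=; apply: ler_sum => l _.
    apply: Re_le; rewrite ?sqs_ge0 //.
    rewrite sqnM; have h1 := cauchy_schwarz (u l) (xi k) (uY k).
    have h2 := cauchy_schwarz (xi k) (v l) (uY k).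
    apply: le_trans (ler_pM (sqn_ge0 _) (sqn_ge0 _) h1 h2) _.
    by rewrite le_eqVlt; apply/orP; left; apply/eqP; ring.
  rewrite raddfB /= => h; rewrite -(ler_pM2l (xi0 k)).
  by have := hxi k; have := FR; lra.
have /choice[Mu hMu] := hu; have /choice[Mv hMv] := hv.
pose B := \sum_(l < n) (Mu l + Mv l).
have bnd (m : nat) : m%:R * e <= B.
  have -> : m%:R * e = \sum_(k < m) e by rewrite big_const_ord iter_addr_0 mulr_natl.
  apply: le_trans (ler_sum _ (fun (k : 'I_m) _ => key k)) _.
  rewrite exchange_big /=; apply: ler_sum => l _; rewrite big_split /= -!sqs_first_blocks.
  have := hMu l _ (first_blocks_uniq m); have := hMv l _ (first_blocks_uniq m).
  by rewrite !sqnorm_onE !lecR => h1 h2; exact: lerD.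
have := bnd (Num.truncn (B / e)).+1; rewrite -ler_pdivlMr //.
by rewrite leNgt truncnS_gt.
Qed.

End BlockSum.

(** * Assembly of the noncompact ghost *)

Section GhostConstruction.
Variable R : realType.
Variable X : choiceType.
Variable d : X -> X -> \bar R.
Hypothesis hd : is_emetric d.
Hypothesis hbg : bounded_geometry d.

Lemma block_exists (r e : R) (N k : nat) (Y : seq X) : 0 < r -> 0 < e ->
  ball_card d r N -> uniq Y ->
  ~ good_kernel d (mem Y) r e (2 * (k.+1%:R * r)) ->
  exists (G : opmat R X) (A : nat -> opmat R X) (xi : X -> R[i]),
  [/\ forall x y, (x \notin Y) || (y \notin Y) -> G x y = 0 /\ forall m, A m x y = 0,
      form_bound G (1 + e / 2 + N%:R) /\ forall m,
        form_bound (fun x y => G x y - A m x y) ((1 + e / 2 + N%:R) / m.+1%:R),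
      forall m, prop_le d (A m) (2 ^+ m * r),
      forall x y, sqn (G x y) <= ghost_rate e N k.+1 &
      e / 2 * sqs Y xi <= complex.Re (form_on G Y xi xi) /\ 0 < sqs Y xi].
Proof.
move=> r0 e0 hN uY bad.
(* The exponent k + 1 rather than k ensures S >= r already for the first block. *)
have rS : r <= 2 * (k.+1%:R * r).
  rewrite mulrA ler_peMl ?(ltW r0) //.
  by have : 1 <= k.+1%:R :> R; [rewrite ler1n|lra].
have [t [xi [tsym tb tloc txi xi0]]] := bad_operator hd uY (ltW r0) rS e0 bad.
have [n [ev [q [qo qc qt q0]]]] := spectral_seq uY tsym.
exists (calc q (fun j => pospart (ev j - (1 + e / 2)))),
  (fun m => calc q (top_approx e N ev m)), (fun x => (xi x)%:C%C).
have c0 : 0 <= 1 + e / 2 + N%:R by rewrite !addr_ge0 // divr_ge0 // ltW.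
split.
- by move=> x y xy; split=> [|m]; exact: (calc_supp q0).
- split=> [|m].
    apply: (calc_bound uY qc q0) => // j.
    apply: le_trans (ev_shift_bound hd uY e0 hN tb qo qt q0 j).
    rewrite ger0_norm ?pospart_ge0 // /pospart.
    by have := ler_norm (ev j - (1 + e / 2)); lra.
  apply: (eq_form_bound (T := calc q (fun j => pospart (ev j - (1 + e / 2)) - top_approx e N ev m j))).
    by move=> x y; rewrite calcB.
  apply: (calc_bound uY qc q0) => [|j]; first by rewrite divr_ge0.
  exact: (top_approx_error hd uY e0 hN tb qo qt q0).
- by move=> m; exact: (top_approx_prop hd r0 tb qo qc qt q0).
- move=> x y; have [yY|yY] := boolP (y \in Y).
    apply: le_trans (calc_entry qo q0 _ _ _) _.
    exact: (top_mass hd uY r0 e0 hN tb tloc qo qc qt q0).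
  rewrite (calc_supp q0) ?yY ?orbT // sqn0 /ghost_rate.
  apply: mulr_ge0; last by apply: exprn_ge0; exact: sqr_ge0.
  apply: mulr_ge0; first exact: sqr_ge0.
  by apply: divr_ge0; [exact: addr_ge0|rewrite divr_ge0 // ltW].
split; first exact: (top_form uY tb qc qt q0 txi).
by move: xi0; congr (_ < _); apply: eq_bigr => x _; rewrite sqnC.
Qed.

Lemma ghost_rate_small (e : R) (N : nat) (eps : R) : 0 < e -> 0 < eps ->
  exists K : nat, forall k, (K <= k)%N -> ghost_rate e N k.+1 < eps.
Proof.
move=> e0 eps0; set M : R := 1 + N%:R; set M' : R := 1 + e / 2 + N%:R.
have M0 : 0 < M by rewrite ltr_pwDl.
have MM' : M < M' by rewrite /M /M' ltrD2r ltrDl divr_gt0.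
have M'0 : 0 < M' by exact: lt_trans MM'.
pose z := (M / M') ^+ 2.
have z0 : 0 <= z by exact: sqr_ge0.
have z1 : `|z| < 1.
  rewrite ger0_norm // /z expr_lt1 // ?ltr_pdivrMr ?mul1r //.
  by rewrite divr_ge0 // ltW.
pose C := M' ^+ 2 * (M / (e / 2)).
have C0 : 0 < C by rewrite mulr_gt0 ?exprn_gt0 // divr_gt0 // divr_gt0.
have := cvg_expr z1; move=> /cvgr_lt/(_ (eps / C)); rewrite divr_gt0 // => /(_ isT).
move=> [K _ hK]; exists K => k Kk.
have /= h := hK k.+1 (leqW Kk).
by rewrite /ghost_rate -/M -/M' -/z -/C mulrC -ltr_pdivlMr.
Qed.

Lemma noncompact_ghost : ~ property_A d -> exists T : opmat R X, ghost d T /\ ~ compact_op T.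
Proof.
move=> /(not_property_A_bad hd)[r [e [r0 e0 bad]]].
have [N hN] := hbg r0.
pose D := 1 + e / 2 + N%:R.
have D0 : 0 < D by rewrite ltr_pwDl // addr_gt0 // divr_gt0.
(* The choice depends on the list of points to avoid, so that the recursion [used] can make the
   blocks disjoint. *)
have /choice[b hb] : forall p : nat * seq X, exists b : seq X * (opmat R X) *
   (nat -> opmat R X) * (X -> R[i]),
   let '(Y, G, A, xi) := b in
  [/\ uniq Y, forall x, x \in Y -> x \notin p.2,
      forall x y, (x \notin Y) || (y \notin Y) -> G x y = 0 /\ forall m, A m x y = 0,
      form_bound G D /\ forall m,
        form_bound (fun x y => G x y - A m x y) (D / m.+1%:R) &
  [/\ forall m, prop_le d (A m) (2 ^+ m * r),
      forall x y, sqn (G x y) <= ghost_rate e N p.1.+1 &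
      e / 2 * sqs Y xi <= complex.Re (form_on G Y xi xi) /\ 0 < sqs Y xi]].
  move=> [k F]; have [Y [uY YF nY]] := bad F (2 * (k.+1%:R * r)).
  have [G [A [xi [h1 h2 h3 h4 h5]]]] := block_exists r0 e0 hN uY nY.
  by exists (Y, G, A, xi).
pose fix used (k : nat) : seq X :=
  if k is k'.+1 then (b (k', used k')).1.1.1 ++ used k' else [::].
pose blk k := b (k, used k).
pose Y k := (blk k).1.1.1; pose G k := (blk k).1.1.2.
pose A m k := (blk k).1.2 m; pose xi k := (blk k).2.
have H k : [/\ uniq (Y k), forall x, x \in Y k -> x \notin used k,
      forall x y, (x \notin Y k) || (y \notin Y k) -> G k x y = 0 /\ forall m, A m k x y = 0,
      form_bound (G k) D /\ forall m,
        form_bound (fun x y => G k x y - A m k x y) (D / m.+1%:R) &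
  [/\ forall m, prop_le d (A m k) (2 ^+ m * r),
      forall x y, sqn (G k x y) <= ghost_rate e N k.+1 &
      e / 2 * sqs (Y k) (xi k) <= complex.Re (form_on (G k) (Y k) (xi k) (xi k))
      /\ 0 < sqs (Y k) (xi k)]].
  have := hb (k, used k); rewrite /Y /G /A /xi -/(blk k).
  by case: (blk k) => [[[? ?] ?] ?].
have uY k : uniq (Y k) by case: (H k).
have used_mem x k l : (k < l)%N -> x \in Y k -> x \in used l.
  move=> + xk; elim: l => [//|l IH]; rewrite ltnS leq_eqVlt => /orP[/eqP <-|kl] /=;
  by rewrite mem_cat ?xk ?(IH kl) ?orbT.
have disjY x k l : x \in Y k -> x \in Y l -> k = l.
  have lt k' l' : x \in Y k' -> x \in Y l' -> (l' <= k')%N.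
    move=> xk xl; rewrite leqNgt; apply/negP => kl.
    by have [_ h _ _ _] := H l'; have /negP[] := h x xl; exact: used_mem kl xk.
  by move=> xk xl; apply/eqP; rewrite eqn_leq !lt.
have G0 : off_zero Y G by move=> k x y xy; have [_ _ h _ _] := H k; case: (h x y xy).
have A0 m : off_zero Y (A m) by move=> k x y xy; have [_ _ h _ _] := H k; case: (h x y xy).
have bG k : form_bound (G k) D by case: (H k) => _ _ _ [].
have bGA m k : form_bound (fun x y => G k x y - A m k x y) (D / m.+1%:R).
  by case: (H k) => _ _ _ [].
have bT : form_bound (block_sum Y G) D by apply: block_sum_bound; rewrite // ltW.
exists (block_sum Y G); split; last first.
  apply: (block_sum_not_compact (e := e / 2) uY disjY (xi := xi)).
  - by rewrite divr_gt0.
  - by move=> k; have [_ _ _ _ [_ _ []]] := H k.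
  - by move=> k; have [_ _ _ _ [_ _ []]] := H k.
split; first (split; first by exists D; apply: form_bound_bounded => //; exact: ltW).
  move=> eps eps0; pose m := Num.truncn (D / eps).
  have Dm : D / m.+1%:R <= eps.
    by rewrite ler_pdivrMr // mulrC -ler_pdivrMr // ltW // truncnS_gt.
  have Dm0 : 0 <= D / m.+1%:R by rewrite divr_ge0 // ltW.
  exists (block_sum Y (A m)); split.
    split; last first.
      exists (2 ^+ m * r); split; first by rewrite mulr_ge0 ?exprn_ge0 // ltW.
      by apply: block_sum_prop => k; have [_ _ _ _ [h _ _]] := H k; exact: h.
    (* The approximant on each block is G - (G - A m), whence this bound uniform in the block. *)
    exists (D + D / m.+1%:R); apply: form_bound_bounded; first by rewrite addr_ge0 // ltW.
    apply: block_sum_bound => //; first by rewrite addr_ge0 // ltW.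
    move=> k; apply: eq_form_bound (form_boundD (bG k) (form_boundN (bGA m k))) => x y.
    by rewrite opprB addrC subrK.
  apply: form_bound_bounded; first exact: ltW.
  apply: form_boundW Dm.
  apply: (@block_sum_bound _ _ Y disjY (fun k x y => G k x y - A m k x y)) => //.
  by move=> k x y xy; rewrite G0 // A0 // subrr.
move=> eps eps0; have eps2 : 0 < eps ^+ 2 by rewrite exprn_gt0.
have [K hK] := ghost_rate_small N e0 eps2.
(* An entry not inside the first K blocks either joins points outside a common block, and is 0, or
   lies in a later block, where the rate is below eps^2. *)
exists (first_blocks Y K) => x y xy; rewrite normc_lt // /block_sum.
set k := block_index Y x.
have [xyk|xyk] := boolP ((x \notin Y k) || (y \notin Y k)).
  by rewrite G0 // sqn0.
have [_ _ _ _ [_ hs _]] := H k; apply: le_lt_trans (hs x y) _; apply: hK.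
rewrite leqNgt; apply/negP => kK; move: xyk; rewrite negb_or !negbK => /andP[xk yk].
by case/orP: xy => /negP; apply; apply/mem_first_blocks; exists k.
Qed.

End GhostConstruction.

Theorem theorem1p3 (R : realType) (X : choiceType) (d : X -> X -> \bar R)
  (hd : is_emetric d) (hbg : bounded_geometry d) :
  (~ property_A d ->
     exists T : opmat R X, ghost d T /\ ~ compact_op T) /\
  (property_A d <-> forall T : opmat R X, ghost d T -> compact_op T).
Proof.
have ng := noncompact_ghost hd hbg; split=> //; split.
  by move=> pA T; exact: property_A_ghost_compact.
move=> H; apply: contrapT => /ng[T [gT]]; apply; exact: H.
Qed.
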